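(* Let $k$ be an algebraically closed field. Let $\mathcal{G}$ be a finite subgroup scheme of a reduced group scheme $\mathcal{H}$ over $k$ and let $\mathcal{N}\subseteq\mathcal{G}$ be a normal subgroup scheme of $\mathcal{H}$ such that $\mathcal{G}/\mathcal{N}$ is linearly reductive. Let $X$ and $M$ be indecomposable $\mathcal{G}$-modules such that there is an almost split exact sequence $$\mathcal{E}:\ 0\to\tau_{\mathcal{N}}(M)\to X^n\to M\to 0$$ of $\mathcal{N}$-modules. Then there is a short exact sequence $$\tilde{\mathcal{E}}:\ 0\to N\to X\otimes_k\operatorname{Irr}_{\mathcal{N}}(X,M)\to M\to 0$$ of $\mathcal{G}$-modules such that $\operatorname{res}_{\mathcal{N}}^{\mathcal{G}}\tilde{\mathcal{E}}=\mathcal{E}$.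
   Context: For a finite group scheme $\mathcal{N}$, $k\mathcal{N}:=k[\mathcal{N}]^*$ (dual of the coordinate ring) is its group algebra, and $\mathcal{N}$-modules are $k\mathcal{N}$-modules. A finite group scheme is linearly reductive if its group algebra is semisimple. $\tau_{\mathcal{N}}$ is the Auslander-Reiten translation of $k\mathcal{N}$, and $\operatorname{res}_{\mathcal{N}}^{\mathcal{G}}$ is restriction from $\mathcal{G}$-modules to $\mathcal{N}$-modules. For $\mathcal{N}$-modules $X,Y$, put $\operatorname{Rad}_{\mathcal{N}}(X,Y):=\{\phi\in\operatorname{Hom}_{\mathcal{N}}(X,Y)\mid\phi\text{ is not an isomorphism}\}$, let $\operatorname{Rad}^2_{\mathcal{N}}(X,Y)$ be the set of all composites $\psi\circ\phi$ with $\phi\in\operatorname{Rad}_{\mathcal{N}}(X,Z)$ and $\psi\in\operatorname{Rad}_{\mathcal{N}}(Z,Y)$ for some $\mathcal{N}$-module $Z$, and put $\operatorname{Irr}_{\mathcal{N}}(X,Y):=\operatorname{Rad}_{\mathcal{N}}(X,Y)/\operatorname{Rad}^2_{\mathcal{N}}(X,Y)$. These are regarded as $k$-vector spaces. $\operatorname{Irr}_{\mathcal{N}}(X,M)$ is regarded as a $\mathcal{G}$-module via the structure induced by the conjugation action $(g.\phi)(x)=g\phi(g^{-1}x)$ on $\operatorname{Hom}_{\mathcal{N}}(X,M)$.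
   Formalization: X is also assumed indecomposable over N (otherwise dim Irr_N(X,M) is not n and the claim fails), and Rad² uses the categorical radical for decomposable middle terms Z, since with mere non-isomorphisms Irr would be 0; both agree for indecomposables. *)

(* Defs.v *)
From HB Require Import structures.
From mathcomp Require Import all_boot all_order all_algebra all_field.

Set Implicit Arguments.
Unset Strict Implicit.
Unset Printing Implicit Defensive.

Import GRing.Theory.
Local Open Scope ring_scope.

Section Modules.
Variables (k : fieldType) (A : falgType k).

Record amod := AMod {
  amod_car :> vectType k;
  mact : A -> 'End(amod_car);
  mact_linear : linear mact;
  mact1 : mact 1 = \1%VF;
  mactM : forall a b, mact (a * b) = (mact a \o mact b)%VF
}.

Definition is_hom (X Y : amod) (f : 'Hom(X, Y)) : Prop :=
  forall a x, f (mact X a x) = mact Y a (f x).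

Definition is_iso (X Y : amod) (f : 'Hom(X, Y)) : Prop :=
  is_hom f /\
  exists2 g : 'Hom(Y, X), (g \o f = \1)%VF & (f \o g = \1)%VF.

Definition submodule (X : amod) (U : {vspace X}) : Prop :=
  forall a, (mact X a @: U <= U)%VS.

Definition indecomposable (X : amod) : Prop :=
  {:X}%VS <> 0%VS /\
  forall U V : {vspace X}, submodule U -> submodule V ->
    (U + V)%VS = fullv -> (U :&: V)%VS = 0%VS -> U = 0%VS \/ V = 0%VS.

Definition completely_reducible (X : amod) : Prop :=
  forall U : {vspace X}, submodule U ->
    exists V : {vspace X},
      [/\ submodule V, (U + V)%VS = fullv & (U :&: V)%VS = 0%VS].

Definition short_exact (L E M : amod) (i : 'Hom(L, E)) (p : 'Hom(E, M)) : Prop :=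
  [/\ is_hom i, is_hom p, lker i = 0%VS, limg i = lker p & limg p = fullv].

Definition split_mono (X Y : amod) (f : 'Hom(X, Y)) : Prop :=
  exists2 g : 'Hom(Y, X), is_hom g & (g \o f = \1)%VF.

Definition split_epi (X Y : amod) (f : 'Hom(X, Y)) : Prop :=
  exists2 g : 'Hom(Y, X), is_hom g & (f \o g = \1)%VF.

Definition right_almost_split (E M : amod) (p : 'Hom(E, M)) : Prop :=
  [/\ is_hom p, ~ split_epi p &
      forall (Z : amod) (h : 'Hom(Z, M)), is_hom h -> ~ split_epi h ->
        exists2 h' : 'Hom(Z, E), is_hom h' & h = (p \o h')%VF].

Definition left_almost_split (L E : amod) (i : 'Hom(L, E)) : Prop :=
  [/\ is_hom i, ~ split_mono i &
      forall (Z : amod) (h : 'Hom(L, Z)), is_hom h -> ~ split_mono h ->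
        exists2 h' : 'Hom(E, Z), is_hom h' & h = (h' \o i)%VF].

Definition almost_split_exact (L E M : amod)
    (i : 'Hom(L, E)) (p : 'Hom(E, M)) : Prop :=
  [/\ short_exact i p, left_almost_split i & right_almost_split p].

(* The radical of the category of finite-dimensional modules.  Between
   indecomposable modules it consists of the non-isomorphisms (lemma radE
   below).  For a general middle term Z in rad2 the bare condition "not an
   isomorphism" is not usable: every f : X -> Y is the composite of the
   non-isomorphisms (id, 0) : X -> X (+) X and (f, 0) : X (+) X -> Y. *)
Definition rad (X Y : amod) (f : 'Hom(X, Y)) : Prop :=
  is_hom f /\
  forall (Z : amod) (g : 'Hom(Z, X)) (h : 'Hom(Y, Z)),
    indecomposable Z -> is_hom g -> is_hom h -> ~ is_iso (h \o f \o g)%VF.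

Definition rad2 (X Y : amod) (f : 'Hom(X, Y)) : Prop :=
  exists (Z : amod) (g : 'Hom(X, Z)) (h : 'Hom(Z, Y)),
    [/\ rad g, rad h & f = (h \o g)%VF].

Lemma is_hom_comp (X Y Z : amod) (g : 'Hom(Y, Z)) (f : 'Hom(X, Y)) :
  is_hom g -> is_hom f -> is_hom (g \o f)%VF.
Proof. by move=> hg hf a x; rewrite !comp_lfunE hf hg. Qed.

Lemma is_hom_inv (X Y : amod) (f : 'Hom(X, Y)) (g : 'Hom(Y, X)) :
  is_hom f -> (g \o f = \1)%VF -> (f \o g = \1)%VF -> is_hom g.
Proof.
move=> hf gf fg a y.
have fgE z : f (g z) = z by rewrite -comp_lfunE fg id_lfunE.
have gfE z : g (f z) = z by rewrite -comp_lfunE gf id_lfunE.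
by rewrite -[in LHS](fgE y) -hf gfE.
Qed.

Lemma split_mono_iso (X Y : amod) (f : 'Hom(X, Y)) :
  {:X}%VS <> 0%VS -> indecomposable Y -> is_hom f -> split_mono f -> is_iso f.
Proof.
move=> X0 [_ Yi] hf [g hg gf]; split=> //; exists g => //.
have gfE z : g (f z) = z by rewrite -comp_lfunE gf id_lfunE.
have sU : submodule (limg f).
  move=> a; apply/subvP=> _ /memv_imgP[_ /memv_imgP[x _ ->] ->].
  by rewrite -hf memv_img ?memvf.
have sV : submodule (lker g).
  move=> a; apply/subvP=> _ /memv_imgP[y + ->].
  by rewrite !memv_ker hg => /eqP ->; rewrite linear0.
have UV : (limg f + lker g)%VS = fullv.
  apply/eqP; rewrite eqEsubv subvf; apply/subvP=> y _.
  rewrite -[y](subrK (f (g y))) addrC memv_add ?memv_img ?memvf //.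
  by rewrite memv_ker linearB /= gfE subrr.
have UV0 : (limg f :&: lker g)%VS = 0%VS.
  apply/eqP; rewrite -subv0; apply/subvP=> y.
  rewrite memv_cap memv_ker => /andP[/memv_imgP[x _ ->]].
  by rewrite gfE => /eqP ->; rewrite linear0 mem0v.
have [U0 | V0] := Yi _ _ sU sV UV UV0.
  case: X0; apply/eqP; rewrite -subv0; apply/subvP=> x _.
  have : f x \in limg f by rewrite memv_img ?memvf.
  by rewrite U0 !memv0 => /eqP fx0; rewrite -[x]gfE fx0 linear0.
apply/lfunP=> y; rewrite comp_lfunE id_lfunE; apply/eqP; rewrite -subr_eq0.
have : f (g y) - y \in lker g by rewrite memv_ker linearB /= gfE subrr.
by rewrite V0 memv0.
Qed.

Lemma radE (X Y : amod) (f : 'Hom(X, Y)) :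
  indecomposable X -> indecomposable Y -> rad f <-> is_hom f /\ ~ is_iso f.
Proof.
move=> Xi Yi; split=> -[hf]; last first.
  move=> nf; split=> // Z g h Zi hg hh [hi [u u1 u2]]; apply: nf.
  have hu := is_hom_inv hi u1 u2.
  have [_ [v v1 v2]] : is_iso g.
    apply: split_mono_iso => //; first by case: Zi.
    exists (u \o (h \o f))%VF; first exact: is_hom_comp hu (is_hom_comp hh hf).
    by rewrite -u1 !comp_lfunA.
  have hv := is_hom_inv hg v1 v2.
  apply: split_mono_iso => //; first by case: Xi.
  exists (g \o u \o h)%VF; first exact: is_hom_comp (is_hom_comp hg hu) hh.
  transitivity (g \o (u \o (h \o f \o g)) \o v)%VF; last by rewrite u1 comp_lfun1r.
  by rewrite -!comp_lfunA v2 comp_lfun1r.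
move=> nf; split=> // -[_ [g g1 g2]].
apply: (nf X \1%VF g Xi).
- by move=> a x; rewrite !id_lfunE.
- exact: is_hom_inv hf g1 g2.
rewrite comp_lfun1r g1; split; first by move=> a x; rewrite !id_lfunE.
by exists \1%VF; rewrite comp_lfun1l.
Qed.

Definition projective (P : amod) : Prop :=
  forall (Y Z : amod) (p : 'Hom(Y, Z)) (f : 'Hom(P, Z)),
    is_hom p -> limg p = fullv -> is_hom f ->
    exists2 g : 'Hom(P, Y), is_hom g & (p \o g = f)%VF.

Definition superfluous (P : amod) (K : {vspace P}) : Prop :=
  forall U : {vspace P}, submodule U -> (U + K)%VS = fullv -> U = fullv.

Definition minimal_projective_presentation (P1 P0 M : amod)
    (f : 'Hom(P1, P0)) (p : 'Hom(P0, M)) : Prop :=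
  [/\ projective P1 /\ projective P0, is_hom f /\ is_hom p,
      limg f = lker p /\ limg p = fullv, superfluous (lker p)
    & superfluous (lker f)].

Fact amull_linear : linear (fun a : A => amull a).
Proof. by move=> c a b; apply/lfunP=> x; rewrite linearP. Qed.
Fact amull_one : amull (1 : A) = \1%VF.
Proof. exact: amull1. Qed.
Fact amull_mul (a b : A) : amull (a * b) = (amull a \o amull b)%VF.
Proof. by apply/lfunP=> x; rewrite comp_lfunE !lfunE /= mulrA. Qed.

Definition regmod : amod := @AMod A (fun a => amull a) amull_linear amull_one amull_mul.

Definition semisimple_algebra : Prop := completely_reducible regmod.

(* T is D Tr M.  For a minimal projective presentation P1 -f-> P0 -> M -> 0,
   Tr M is the cokernel of Hom_A(P0, A) -> Hom_A(P1, A), psi |-> psi o f, a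
   right A-module under (phi . a)(x) = phi(x) a.  Hence D Tr M is the space of
   linear forms on Hom_A(P1, A) that kill all psi o f, with the left action
   (a . xi)(phi) = xi(phi . a); beta is an isomorphism from T onto it.  A form
   on the subspace Hom_A(P1, A) is given as the restriction of a form on the
   space 'Hom(P1, A) of all linear maps. *)
Definition is_AR_translate (M T : amod) : Prop :=
  exists (P1 P0 : amod) (f : 'Hom(P1, P0)) (p : 'Hom(P0, M))
         (beta : 'Hom(T, 'Hom('Hom(P1, regmod), k^o))),
    minimal_projective_presentation f p /\
    [/\ forall a t (phi : 'Hom(P1, regmod)), is_hom phi ->
          beta (mact T a t) phi = beta t (amulr a \o phi)%VF,
        forall t (psi : 'Hom(P0, regmod)), is_hom psi ->
          beta t (psi \o f)%VF = 0,
        forall t, (forall phi : 'Hom(P1, regmod), is_hom phi -> beta t phi = 0) ->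
          t = 0
      & forall xi : 'Hom('Hom(P1, regmod), k^o),
          (forall psi : 'Hom(P0, regmod), is_hom psi -> xi (psi \o f)%VF = 0) ->
          exists t, forall phi : 'Hom(P1, regmod), is_hom phi -> beta t phi = xi phi].

Section Power.
Variables (X : amod) (n : nat).

Definition pow_fun (f : 'End(X)) (v : {ffun 'I_n -> X}) : {ffun 'I_n -> X} :=
  [ffun i => f (v i)].
Fact pow_fun_linear f : linear (pow_fun f).
Proof. by move=> c u v; apply/ffunP=> i; rewrite !ffunE linearP. Qed.
HB.instance Definition _ f :=
  GRing.isLinear.Build k {ffun 'I_n -> X} {ffun 'I_n -> X} *:%R (pow_fun f)
    (pow_fun_linear f).
Definition pow_act (a : A) := linfun (pow_fun (mact X a)).
Fact pow_actE a v i : pow_act a v i = mact X a (v i).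
Proof. by rewrite lfunE /= ffunE. Qed.
Fact pow_act_linear : linear pow_act.
Proof.
move=> c a b; apply/lfunP=> v; apply/ffunP=> i.
rewrite pow_actE mact_linear add_lfunE scale_lfunE.
by rewrite [in RHS]add_lfunE scale_lfunE ffunE ffunE !pow_actE.
Qed.
Fact pow_act1 : pow_act 1 = \1%VF.
Proof. by apply/lfunP=> v; apply/ffunP=> i; rewrite pow_actE mact1 !id_lfunE. Qed.
Fact pow_actM a b : pow_act (a * b) = (pow_act a \o pow_act b)%VF.
Proof.
by apply/lfunP=> v; apply/ffunP=> i; rewrite pow_actE mactM !comp_lfunE !pow_actE.
Qed.
Definition powmod : amod :=
  @AMod {ffun 'I_n -> X} pow_act pow_act_linear pow_act1 pow_actM.
End Power.

End Modules.

(* Affine group schemes are given by their commutative Hopf algebras, with the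
   comultiplication in Sweedler form: a list s of pairs stands for the
   tensor \sum_(p <- s) p.1 (x) p.2 in U (x) V, and two lists define the same
   tensor iff every bilinear map takes the same value on them. *)
Definition tensor_eq (k : fieldType) (U V : lmodType k) (s t : seq (U * V)) : Prop :=
  forall (W : lmodType k) (b : U -> V -> W), bilinear_for *:%R *:%R b ->
    \sum_(p <- s) b p.1 p.2 = \sum_(p <- t) b p.1 p.2.

Definition trilinear (k : fieldType) (U W : lmodType k) (t : U -> U -> U -> W) : Prop :=
  [/\ forall v w, linear (fun u => t u v w), forall u w, linear (fun v => t u v w)
    & forall u v, linear (t u v)].

Record hopf (k : fieldType) (A : algType k) := Hopf {
  hopf_mulC : commutative ( *%R : A -> A -> A);
  hcomul : A -> seq (A * A);
  hcounit : {lrmorphism A -> k^o};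
  hantip : {linear A -> A};
  hcomul_linear : forall c a b,
    tensor_eq (hcomul (c *: a + b))
              ([seq (c *: p.1, p.2) | p <- hcomul a] ++ hcomul b);
  hcomul1 : tensor_eq (hcomul 1) [:: (1, 1)];
  hcomulM : forall a b,
    tensor_eq (hcomul (a * b))
              [seq (p.1 * q.1, p.2 * q.2) | p <- hcomul a, q <- hcomul b];
  hcomulA : forall a (W : lmodType k) (t : A -> A -> A -> W), trilinear t ->
    \sum_(p <- hcomul a) \sum_(q <- hcomul p.1) t q.1 q.2 p.2 =
    \sum_(p <- hcomul a) \sum_(q <- hcomul p.2) t p.1 q.1 q.2;
  hcounitl : forall a, \sum_(p <- hcomul a) (hcounit p.1 : k) *: p.2 = a;
  hcounitr : forall a, \sum_(p <- hcomul a) (hcounit p.2 : k) *: p.1 = a;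
  hantipl : forall a, \sum_(p <- hcomul a) hantip p.1 * p.2 = (hcounit a : k)%:A;
  hantipr : forall a, \sum_(p <- hcomul a) p.1 * hantip p.2 = (hcounit a : k)%:A
}.

Record groupScheme (k : fieldType) := GroupScheme {
  coordring :> algType k;
  coordring_hopf : hopf coordring
}.

Record finGroupScheme (k : fieldType) := FinGroupScheme {
  fcoordring : falgType k;
  fcoordring_hopf : hopf fcoordring
}.

Definition fin_groupScheme (k : fieldType) (G : finGroupScheme k) : groupScheme k :=
  @GroupScheme k (fcoordring G) (fcoordring_hopf G).
Coercion fin_groupScheme : finGroupScheme >-> groupScheme.

Definition comul (k : fieldType) (G : groupScheme k) : G -> seq (G * G) :=
  hcomul (coordring_hopf G).
Definition counit (k : fieldType) (G : groupScheme k) : {lrmorphism G -> k^o} :=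
  hcounit (coordring_hopf G).
Definition antip (k : fieldType) (G : groupScheme k) : {linear G -> G} :=
  hantip (coordring_hopf G).

Definition reduced (k : fieldType) (H : groupScheme k) : Prop :=
  forall (a : H) (n : nat), a ^+ n = 0 -> a = 0.

(* gs_hom G H : homomorphisms G -> H, given by their comorphisms k[H] -> k[G]. *)
Record gs_hom (k : fieldType) (G H : groupScheme k) := GsHom {
  comorph :> {lrmorphism H -> G};
  comorph_comul : forall a,
    tensor_eq (comul (comorph a)) [seq (comorph p.1, comorph p.2) | p <- comul a];
  comorph_counit : forall a, counit G (comorph a) = counit H a
}.

Definition closed_immersion (k : fieldType) (G H : groupScheme k) (i : gs_hom G H) : Prop :=
  forall b : G, exists a : H, i a = b.

Definition pt_mul (k : fieldType) (H : groupScheme k) (R : comAlgType k)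
    (x y : H -> R) : H -> R :=
  fun a => \sum_(p <- comul a) x p.1 * y p.2.
Definition pt_inv (k : fieldType) (H : groupScheme k) (R : comAlgType k)
    (x : H -> R) : H -> R :=
  fun a => x (antip H a).

(* N, embedded by r : k[H] -> k[N], is normal: for every commutative k-algebra R
   the image of N(R) in H(R) is stable under conjugation by H(R). *)
Definition normal_via (k : fieldType) (H N : groupScheme k) (r : H -> N) : Prop :=
  forall (R : comAlgType k) (h : {lrmorphism H -> R}) (x : {lrmorphism N -> R}),
    exists y : {lrmorphism N -> R}, forall a : H,
      y (r a) = pt_mul (pt_mul h (fun b => x (r b))) (pt_inv h) a.

(* q : G -> Q is the quotient of G by N: k[Q] is identified with k[G]^N, the
   functions f with f(g n) = f(g). *)
Definition is_quotient (k : fieldType) (N G Q : groupScheme k)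
    (i : gs_hom N G) (q : gs_hom G Q) : Prop :=
  injective q /\
  forall a : G,
    (exists b : Q, q b = a) <->
    tensor_eq [seq (p.1, i p.2) | p <- comul a] [:: (a, 1)].

Lemma tensor_eq_linear (k : fieldType) (A : algType k) (W : lmodType k)
    (D : A -> seq (A * A)) (b : A -> A -> W) :
  (forall c x y, tensor_eq (D (c *: x + y)) ([seq (c *: p.1, p.2) | p <- D x] ++ D y)) ->
  bilinear_for *:%R *:%R b ->
  linear (fun a => \sum_(p <- D a) b p.1 p.2).
Proof.
move=> DP bP c x y; rewrite (DP c x y _ _ bP) big_cat big_map scaler_sumr /=.
congr (_ + _); apply: eq_bigr => p _.
have h0 : b 0 p.2 = 0.
  by have /= := bP.1 p.2 (-1) 0 0; rewrite scaler0 addr0 scaleN1r addNr.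
by have /= := bP.1 p.2 c p.1 0; rewrite !addr0 h0 addr0.
Qed.

Lemma exchange_big4 (V : nmodType) (I J K L : Type) (r : seq I) (s : seq J)
    (t : seq K) (u : seq L) (F : I -> J -> K -> L -> V) :
  \sum_(i <- r) \sum_(j <- s) \sum_(p <- t) \sum_(q <- u) F i j p q =
  \sum_(p <- t) \sum_(q <- u) \sum_(i <- r) \sum_(j <- s) F i j p q.
Proof.
under eq_bigr => i _ do rewrite exchange_big /=.
rewrite exchange_big /=; apply: eq_bigr => p _.
under eq_bigr => i _ do rewrite exchange_big /=.
by rewrite exchange_big.
Qed.

(* The group algebra kG = k[G]^*, with the convolution product. *)
Definition galg (k : fieldType) (G : finGroupScheme k) : Type := 'Hom(fcoordring G, k^o).

Section GroupAlgebra.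
Variables (k : fieldType) (G : finGroupScheme k).
Local Notation kG := (galg G).
Local Notation OG := (fcoordring G).

HB.instance Definition _ := Vector.on kG.

Definition galg_fun (f : kG) : OG -> k := fun_of_lfun (f : 'Hom(OG, k^o)).
Coercion galg_fun : galg >-> Funclass.

Fact galgP (f g : kG) : (forall x, f x = g x) -> f = g.
Proof. by move=> h; apply/lfunP. Qed.
Fact galg_linear (f : kG) c x y : f (c *: x + y) = c * f x + f y.
Proof. by rewrite /galg_fun linearP. Qed.
Fact galgD (f g : kG) x : (f + g : kG) x = f x + g x.
Proof. by rewrite /galg_fun lfunE. Qed.
Fact galgZ c (f : kG) x : (c *: f : kG) x = c * f x.
Proof. by rewrite /galg_fun lfunE. Qed.

Fact galg_sumf (I : Type) (r : seq I) (F : I -> kG) x :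
  (\sum_(i <- r) F i : kG) x = \sum_(i <- r) F i x.
Proof. by rewrite /galg_fun sum_lfunE. Qed.

Definition conv_fun (f g : kG) (a : OG) : k^o := \sum_(p <- comul (G := G) a) f p.1 * g p.2.

Fact conv_bilinear (f g : kG) :
  @bilinear_for k OG OG k^o *:%R *:%R (fun x y => f x * g y).
Proof.
split=> u c x y /=; rewrite galg_linear ?mulrDl ?mulrDr.
  by rewrite -mulrA.
by rewrite mulrCA.
Qed.

Fact conv_linear f g : linear (conv_fun f g).
Proof.
apply: (@tensor_eq_linear k OG k^o (comul (G := G)) (fun x y => f x * g y)).
  exact: hcomul_linear.
exact: conv_bilinear.
Qed.
HB.instance Definition _ f g :=
  GRing.isLinear.Build k OG k^o *:%R (conv_fun f g) (conv_linear f g).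

Definition galg_mul (f g : kG) : kG := linfun (conv_fun f g).
Definition galg_one : kG := linfun (counit G).

Fact galg_mulE f g a : galg_mul f g a = \sum_(p <- comul (G := G) a) f p.1 * g p.2.
Proof. by rewrite /galg_fun lfunE. Qed.
Fact galg_oneE a : galg_one a = counit G a.
Proof. by rewrite /galg_fun lfunE. Qed.

Fact galg_mulA : associative galg_mul.
Proof.
move=> f g h; apply: galgP => a; rewrite !galg_mulE.
have tP : @trilinear k OG k^o (fun x y z => f x * g y * h z).
  split=> u v c x y /=; rewrite galg_linear.
  - by rewrite !mulrDl -!mulrA.
  - by rewrite mulrDr mulrDl -!mulrA [f u * (c * _)]mulrCA.
  - by rewrite mulrDr mulrCA.
have := hcomulA (fcoordring_hopf G) a tP.
rewrite -/(comul (G := G)) => E.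
transitivity (\sum_(p <- comul (G := G) a) \sum_(q <- comul (G := G) p.2)
                f p.1 * g q.1 * h q.2).
  apply: eq_bigr => p _; rewrite galg_mulE mulr_sumr.
  by apply: eq_bigr => q _; rewrite mulrA.
rewrite -[LHS]E; apply: eq_bigr => p _.
by rewrite galg_mulE mulr_suml.
Qed.

Fact galg_sum (f : kG) (I : Type) (r : seq I) (F : I -> OG) :
  f (\sum_(i <- r) F i) = \sum_(i <- r) f (F i).
Proof. by rewrite /galg_fun linear_sum. Qed.
Fact galg_scale (f : kG) c x : f (c *: x) = c * f x.
Proof. by rewrite /galg_fun linearZ. Qed.

Fact galg_mul1f : left_id galg_one galg_mul.
Proof.
move=> f; apply: galgP => a; rewrite galg_mulE.
rewrite -[in RHS](hcounitl (fcoordring_hopf G) a) galg_sum.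
by apply: eq_bigr => p _; rewrite galg_oneE galg_scale.
Qed.
Fact galg_mulf1 : right_id galg_one galg_mul.
Proof.
move=> f; apply: galgP => a; rewrite galg_mulE.
rewrite -[in RHS](hcounitr (fcoordring_hopf G) a) galg_sum.
by apply: eq_bigr => p _; rewrite galg_oneE galg_scale mulrC.
Qed.
Fact galg_mulDl : left_distributive galg_mul +%R.
Proof.
move=> f g h; apply: galgP => a; rewrite galgD !galg_mulE -big_split.
by apply: eq_bigr => p _; rewrite galgD mulrDl.
Qed.
Fact galg_mulDr : right_distributive galg_mul +%R.
Proof.
move=> f g h; apply: galgP => a; rewrite galgD !galg_mulE -big_split.
by apply: eq_bigr => p _; rewrite galgD mulrDr.
Qed.
Fact galg_one_neq0 : galg_one != 0.
Proof.
apply/eqP=> h; have := congr1 (fun f : kG => f 1) h.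
rewrite galg_oneE rmorph1 /galg_fun zero_lfunE => /eqP.
by rewrite (oner_eq0 k).
Qed.
HB.instance Definition _ := GRing.Zmodule_isNzRing.Build kG
  galg_mulA galg_mul1f galg_mulf1 galg_mulDl galg_mulDr galg_one_neq0.

Fact galg_scaleAl c (f g : kG) : c *: (f * g) = (c *: f) * g.
Proof.
apply: galgP => a; rewrite galgZ !galg_mulE mulr_sumr.
by apply: eq_bigr => p _; rewrite galgZ mulrA.
Qed.
HB.instance Definition _ := GRing.Lmodule_isLalgebra.Build k kG galg_scaleAl.
Fact galg_scaleAr c (f g : kG) : c *: (f * g) = f * (c *: g).
Proof.
apply: galgP => a; rewrite galgZ !galg_mulE mulr_sumr.
by apply: eq_bigr => p _; rewrite galgZ mulrCA.
Qed.
HB.instance Definition _ := GRing.Lalgebra_isAlgebra.Build k kG galg_scaleAr.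
HB.instance Definition _ := Algebra_isFalgebra.Build k kG.

End GroupAlgebra.

Definition gmod (k : fieldType) (G : finGroupScheme k) := amod (galg G).

Definition linearly_reductive (k : fieldType) (G : finGroupScheme k) : Prop :=
  semisimple_algebra (galg G).

Section DualHopf.
Variables (k : fieldType) (G : finGroupScheme k).
Local Notation kG := (galg G).
Local Notation OG := (fcoordring G).
Local Notation n := (\dim {:OG}).
Local Notation e := (vbasis {:OG}).

Definition dual_fun (i : 'I_n) (x : OG) : k^o := coord e i x.
Fact dual_linear i : linear (dual_fun i).
Proof. by move=> c x y; rewrite /dual_fun linearP. Qed.
HB.instance Definition _ i :=
  GRing.isLinear.Build k OG k^o *:%R (dual_fun i) (dual_linear i).
Definition dual_basis (i : 'I_n) : kG := linfun (dual_fun i).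

(* The comultiplication of kG, dual to the product of k[G] (lemma gcomulE). *)
Definition gcomul (a : kG) : seq (kG * kG) :=
  [seq (a (e`_i * e`_j) *: dual_basis i, dual_basis j) | i : 'I_n <- enum 'I_n, j : 'I_n <- enum 'I_n].

Definition gantip (a : kG) : kG := linfun ((a : 'Hom(OG, k^o)) \o antip G).

Fact dual_basisE i x : dual_basis i x = coord e i x.
Proof. by rewrite /galg_fun lfunE. Qed.

Fact basis_expand (x : OG) : x = \sum_(i < n) coord e i x *: e`_i.
Proof. exact: (coord_vbasis (memvf x)). Qed.

Fact sum_gcomul (W : nmodType) (F : kG -> kG -> W) a :
  \sum_(p <- gcomul a) F p.1 p.2 =
  \sum_(i < n) \sum_(j < n) F (a (e`_i * e`_j) *: dual_basis i) (dual_basis j).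
Proof.
rewrite /gcomul big_allpairs_dep -(big_enum _ _) /=.
by apply: eq_bigr => i _; rewrite -(big_enum _ _).
Qed.

Lemma gcomulE a x y : \sum_(p <- gcomul a) p.1 x * p.2 y = a (x * y).
Proof.
rewrite (sum_gcomul (fun f g => f x * g y)).
rewrite [in RHS](basis_expand x) mulr_suml galg_sum; apply: eq_bigr => i _.
rewrite [in RHS](basis_expand y) mulr_sumr galg_sum; apply: eq_bigr => j _.
rewrite galgZ !dual_basisE -scalerAl -scalerAr !galg_scale.
by rewrite [RHS]mulrA [RHS]mulrC mulrA.
Qed.

Fact galg_expand (a : kG) : a = \sum_(i < n) a e`_i *: dual_basis i.
Proof.
apply: galgP => x; rewrite [in LHS](basis_expand x) galg_sum galg_sumf.
by apply: eq_bigr => i _; rewrite galg_scale galgZ dual_basisE mulrC.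
Qed.

(* Tensors in kG (x) kG are separated by the points of G x G. *)
Lemma tensor_eq_galg (s t : seq (kG * kG)) :
  (forall x y, \sum_(p <- s) p.1 x * p.2 y = \sum_(p <- t) p.1 x * p.2 y) ->
  tensor_eq s t.
Proof.
move=> st W b bP.
have E (r : seq (kG * kG)) : \sum_(p <- r) b p.1 p.2 =
    \sum_(i < n) \sum_(j < n) (\sum_(p <- r) p.1 e`_i * p.2 e`_j) *: b (dual_basis i) (dual_basis j).
  have b0l v : b 0 v = 0.
    by have /= := bP.1 v (-1) 0 0; rewrite scaler0 addr0 scaleN1r addNr.
  have b0r u : b u 0 = 0.
    by have /= := bP.2 u (-1) 0 0; rewrite scaler0 addr0 scaleN1r addNr.
  have bsl I (q : seq I) c f v : b (\sum_(i <- q) c i *: f i) v = \sum_(i <- q) c i *: b (f i) v.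
    elim: q => [|i q IH]; first by rewrite !big_nil b0l.
    by rewrite !big_cons; have /= -> := bP.1 v (c i) (f i) _; rewrite IH.
  have bsr I (q : seq I) c f u : b u (\sum_(i <- q) c i *: f i) = \sum_(i <- q) c i *: b u (f i).
    elim: q => [|i q IH]; first by rewrite !big_nil b0r.
    by rewrite !big_cons; have /= -> := bP.2 u (c i) (f i) _; rewrite IH.
  under [RHS]eq_bigr => i _ do under eq_bigr => j _ do rewrite scaler_suml.
  under [RHS]eq_bigr => i _ do rewrite exchange_big /=.
  rewrite exchange_big /=; apply: eq_bigr => p _.
  rewrite {1}(galg_expand p.1) bsl; apply: eq_bigr => i _.
  rewrite {1}(galg_expand p.2) bsr scaler_sumr; apply: eq_bigr => j _.
  by rewrite scalerA.
by rewrite !E; apply: eq_bigr => i _; apply: eq_bigr => j _; rewrite st.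
Qed.

Lemma gcomul_linear c (a b : kG) :
  tensor_eq (gcomul (c *: a + b))
            ([seq (c *: p.1, p.2) | p <- gcomul a] ++ gcomul b).
Proof.
apply: tensor_eq_galg => x y; rewrite big_cat big_map /= !gcomulE galgD galgZ.
congr (_ + _); rewrite -gcomulE mulr_sumr; apply: eq_bigr => p _.
by rewrite galgZ mulrA.
Qed.

Lemma gcomul1 : tensor_eq (gcomul 1) [:: (1, 1)].
Proof.
apply: tensor_eq_galg => x y; rewrite big_seq1 gcomulE /=.
by rewrite -[1]/(galg_one G) !galg_oneE rmorphM.
Qed.

Lemma gcomulM (a b : kG) :
  tensor_eq (gcomul (a * b))
            [seq (p.1 * q.1, p.2 * q.2) | p <- gcomul a, q <- gcomul b].
Proof.
apply: tensor_eq_galg => x y; rewrite gcomulE big_allpairs_dep /=.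
have mE (f g : kG) z : (f * g : kG) z = \sum_(p <- comul (G := G) z) f p.1 * g p.2.
  exact: galg_mulE.
rewrite mE.
have bP : @bilinear_for k OG OG k^o *:%R *:%R (fun u v => a u * b v).
  exact: conv_bilinear.
rewrite (hcomulM (fcoordring_hopf G) x y bP) big_allpairs_dep /=.
transitivity (\sum_(r <- comul (G := G) x) \sum_(s <- comul (G := G) y)
    \sum_(p <- gcomul a) \sum_(q <- gcomul b)
      (p.1 r.1 * q.1 r.2) * (p.2 s.1 * q.2 s.2)).
  apply: eq_bigr => r _; apply: eq_bigr => s _.
  rewrite -!gcomulE mulr_suml; apply: eq_bigr => p _.
  by rewrite mulr_sumr; apply: eq_bigr => q _; rewrite mulrACA.
transitivity (\sum_(p <- gcomul a) \sum_(q <- gcomul b)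
    \sum_(r <- comul (G := G) x) \sum_(s <- comul (G := G) y)
      (p.1 r.1 * q.1 r.2) * (p.2 s.1 * q.2 s.2)).
  exact: (@exchange_big4 k).
apply: eq_bigr => p _; apply: eq_bigr => q _.
rewrite !mE mulr_suml; apply: eq_bigr => r _.
by rewrite mulr_sumr.
Qed.

End DualHopf.

Section Restriction.
Variables (k : fieldType) (N G : finGroupScheme k) (i : gs_hom N G).

(* kN -> kG, the transpose of k[G] -> k[N]. *)
Definition galg_map (a : galg N) : galg G :=
  linfun ((a : 'Hom(fcoordring N, k^o)) \o comorph i).

Fact galg_mapE a x : galg_map a x = a (i x).
Proof. by rewrite /galg_fun lfunE. Qed.
Fact galg_map_linear : linear galg_map.
Proof. by move=> c a b; apply: galgP => x; rewrite galgD galgZ !galg_mapE galgD galgZ. Qed.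
Fact galg_map1 : galg_map 1 = 1.
Proof.
apply: galgP => x; rewrite galg_mapE -[1]/(galg_one N) -[1]/(galg_one G).
by rewrite !galg_oneE comorph_counit.
Qed.
Fact galg_mapM a b : galg_map (a * b) = galg_map a * galg_map b.
Proof.
apply: galgP => x; rewrite galg_mapE -[a * b]/(galg_mul a b) galg_mulE.
rewrite -[galg_map a * _]/(galg_mul (galg_map a) (galg_map b)) galg_mulE.
have := comorph_comul i x (conv_bilinear a b); rewrite big_map /= => ->.
by apply: eq_bigr => p _; rewrite !galg_mapE.
Qed.

Variable X : gmod G.
Definition res_act (a : galg N) : 'End(X) := mact X (galg_map a).
Fact res_act_linear : linear res_act.
Proof. by move=> c a b; rewrite /res_act galg_map_linear mact_linear. Qed.
Fact res_act1 : res_act 1 = \1%VF.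
Proof. by rewrite /res_act galg_map1 mact1. Qed.
Fact res_actM a b : res_act (a * b) = (res_act a \o res_act b)%VF.
Proof. by rewrite /res_act galg_mapM mactM. Qed.
Definition res : gmod N :=
  @AMod k (galg N) X res_act res_act_linear res_act1 res_actM.
End Restriction.

(* The conjugation action of kG on Hom_k(X, Y): a.phi = \sum a_1 phi S(a_2),
   the linear extension of (g.phi)(x) = g phi(g^-1 x). *)
Definition conj_act (k : fieldType) (G : finGroupScheme k) (X Y : gmod G)
    (a : galg G) (phi : 'Hom(X, Y)) : 'Hom(X, Y) :=
  \sum_(p <- gcomul a) (mact Y p.1 \o phi \o mact X (gantip p.2))%VF.

(* The tensor product of finite-dimensional spaces, as Hom_k(V^*, U), with
   u (x) v the map xi |-> xi(v) u. *)
Section Tensor.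
Variables (k : fieldType) (U V : vectType k).

Definition tensor : vectType k := 'Hom('Hom(V, k^o), U).

Definition tens_fun (u : U) (v : V) (xi : 'Hom(V, k^o)) : U := (xi v : k) *: u.
Fact tens_linear u v : linear (tens_fun u v).
Proof. by move=> c x y; rewrite /tens_fun !lfunE /= scalerDl scalerA lfunE. Qed.
HB.instance Definition _ u v :=
  GRing.isLinear.Build k 'Hom(V, k^o) U *:%R (tens_fun u v) (tens_linear u v).
Definition tens u v : tensor := linfun (tens_fun u v).

Definition transp_fun (g : 'End(V)) (xi : 'Hom(V, k^o)) : 'Hom(V, k^o) := (xi \o g)%VF.
Fact transp_linear g : linear (transp_fun g).
Proof. by move=> c x y; rewrite /transp_fun comp_lfunDl comp_lfunZl. Qed.
HB.instance Definition _ g :=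
  GRing.isLinear.Build k 'Hom(V, k^o) 'Hom(V, k^o) *:%R (transp_fun g) (transp_linear g).

Definition tens_map_fun (f : 'End(U)) (g : 'End(V)) (t : tensor) : tensor :=
  (f \o t \o linfun (transp_fun g))%VF.
Fact tens_map_linear f g : linear (tens_map_fun f g).
Proof.
move=> c x y; apply/lfunP=> xi.
by rewrite add_lfunE scale_lfunE !comp_lfunE add_lfunE scale_lfunE linearP.
Qed.
HB.instance Definition _ f g :=
  GRing.isLinear.Build k tensor tensor *:%R (tens_map_fun f g) (tens_map_linear f g).
Definition tens_map f g : 'End(tensor) := linfun (tens_map_fun f g).

Fact tens_mapE f g (t : tensor) xi : tens_map f g t xi = f (t (xi \o g)%VF).
Proof. by rewrite lfunE /= /tens_map_fun !comp_lfunE lfunE. Qed.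

Lemma tens_map_tens f g u v : tens_map f g (tens u v) = tens (f u) (g v).
Proof.
apply/lfunP=> xi; rewrite tens_mapE !lfunE /= /tens_fun comp_lfunE.
by rewrite linearZ.
Qed.

Fact tens_map_bilinear : bilinear_for *:%R *:%R tens_map.
Proof.
split=> u c x y /=; apply/lfunP=> t; apply/lfunP=> xi.
  by rewrite !(add_lfunE, scale_lfunE, tens_mapE).
rewrite !(add_lfunE, scale_lfunE, tens_mapE) comp_lfunDr -comp_lfunZr.
by rewrite !linearP.
Qed.

Fact tens_map1 : tens_map \1%VF \1%VF = \1%VF.
Proof.
by apply/lfunP=> t; apply/lfunP=> xi; rewrite tens_mapE !id_lfunE comp_lfun1r.
Qed.
Fact tens_mapM f f' g g' :
  tens_map (f \o f')%VF (g \o g')%VF = (tens_map f g \o tens_map f' g')%VF.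
Proof.
apply/lfunP=> t; apply/lfunP=> xi.
by rewrite comp_lfunE !tens_mapE comp_lfunE comp_lfunA.
Qed.
End Tensor.

Section DiagonalAction.
Variables (k : fieldType) (G : finGroupScheme k) (X Y : gmod G) (T : vectType k).
Variable tm : 'End(X) -> 'End(Y) -> 'End(T).
Hypothesis tm_bilinear : bilinear_for *:%R *:%R tm.
Hypothesis tm1 : tm \1%VF \1%VF = \1%VF.
Hypothesis tmM : forall f f' g g', tm (f \o f')%VF (g \o g')%VF = (tm f g \o tm f' g')%VF.

Definition diag_act (a : galg G) : 'End(T) :=
  \sum_(p <- gcomul a) tm (mact X p.1) (mact Y p.2).

Fact diag_act_bilinear :
  @bilinear_for k (galg G) (galg G) 'End(T) *:%R *:%R
    (fun a b => tm (mact X a) (mact Y b)).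
Proof.
split=> u c x y /=; rewrite mact_linear.
  by have /= -> := tm_bilinear.1 (mact Y u) c (mact X x) (mact X y).
by have /= -> := tm_bilinear.2 (mact X u) c (mact Y x) (mact Y y).
Qed.

Fact diag_act_linear : linear diag_act.
Proof. exact: tensor_eq_linear (@gcomul_linear k G) diag_act_bilinear. Qed.
Fact diag_act1 : diag_act 1 = \1%VF.
Proof. by rewrite /diag_act (gcomul1 diag_act_bilinear) big_seq1 !mact1 tm1. Qed.
Fact diag_actM a b : diag_act (a * b) = (diag_act a \o diag_act b)%VF.
Proof.
rewrite /diag_act (gcomulM a b diag_act_bilinear) big_allpairs_dep /=.
apply/lfunP=> t; rewrite comp_lfunE !sum_lfunE; apply: eq_bigr => p _.
rewrite sum_lfunE linear_sum; apply: eq_bigr => q _.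
by rewrite !mactM tmM comp_lfunE.
Qed.
Definition diag_mod : gmod G :=
  @AMod k (galg G) T diag_act diag_act_linear diag_act1 diag_actM.
End DiagonalAction.

Definition tensmod (k : fieldType) (G : finGroupScheme k) (X Y : gmod G) : gmod G :=
  diag_mod (@tens_map_bilinear k X Y) (@tens_map1 k X Y) (@tens_mapM k X Y).

Lemma tensmodE (k : fieldType) (G : finGroupScheme k) (X Y : gmod G)
    (a : galg G) (x : X) (y : Y) :
  mact (tensmod X Y) a (tens x y) =
  \sum_(p <- gcomul a) tens (mact X p.1 x) (mact Y p.2 y).
Proof. by rewrite sum_lfunE; apply: eq_bigr => p _; rewrite tens_map_tens. Qed.

(* I, with the projection pr, is Irr_N(X, Y) = Rad_N(X, Y) / Rad^2_N(X, Y) with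
   the G-module structure induced by conjugation.  Only the restriction of pr to
   Rad_N(X, Y) matters. *)
Definition is_Irr (k : fieldType) (N G : finGroupScheme k) (i : gs_hom N G)
    (X Y I : gmod G) (pr : 'Hom('Hom(X, Y), I)) : Prop :=
  let radN (phi : 'Hom(X, Y)) := @rad k (galg N) (res i X) (res i Y) phi in
  let rad2N (phi : 'Hom(X, Y)) := @rad2 k (galg N) (res i X) (res i Y) phi in
  [/\ forall phi, radN phi -> (pr phi = 0 <-> rad2N phi),
      forall v, exists2 phi, radN phi & pr phi = v
    & forall a phi, radN phi ->
        radN (conj_act a phi) /\ pr (conj_act a phi) = mact I a (pr phi)].

(* Main.v *)
Require Import Defs.
From HB Require Import structures.
From mathcomp Require Import all_boot all_order all_algebra all_field.
From Stdlib Require Import Classical_Prop.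
Import Defs.

Set Implicit Arguments.
Unset Strict Implicit.
Unset Printing Implicit Defensive.

Import GRing.Theory.
Local Open Scope ring_scope.

(** Write X^n -> M for the right almost split map p and s v for a lift of
    v : I = Irr_N(X, M) to Rad_N(X, M).

    N acts trivially on Hom_N(X, M), hence on I, and a vector fixed by N is killed
    by the kernel of kG -> kQ because its matrix coefficients lie in k[G]^N = k[Q].
    An integral of the semisimple algebra kQ therefore averages a linear section
    of Rad_N(X, M) -> I into a G-equivariant section s, which amounts to a
    G-linear map p' : X (x) I -> M, x (x) v |-> s v x.

    Over N, p' lies in the radical, so it factors through p as p o b.  The components
    p_l of p lie in the radical as well, with classes v_l in I, and
    b'(x_l)_l = \sum_l x_l (x) v_l satisfies p = p' o b' + p o w with w radical,
    since rad^2 factors through p by radical maps.  Hence p o b o b' = p o (1 - w)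
    with 1 - w invertible, and b o b' is invertible because p is right minimal.
    Finally b' is onto: End_N(X) is k plus its radical, so the v_l span I.
    Thus b is an isomorphism from p' to p, and it identifies the kernels. *)

(** * Modules over a finite-dimensional algebra *)

Section AlgebraModules.
Variables (k : fieldType) (A : falgType k).
Implicit Types X Y Z E L M : amod A.

Lemma mactD X a b x : mact X (a + b) x = mact X a x + mact X b x.
Proof.
by have := @mact_linear k A X 1 a b; rewrite !scale1r => ->; rewrite add_lfunE.
Qed.

Lemma mact0 X x : mact X 0 x = 0.
Proof. by have := mactD 0 0 x; rewrite addr0 -[LHS]addr0 => /addrI. Qed.

Lemma mactZ X c a x : mact X (c *: a) x = c *: mact X a x.
Proof.
have := @mact_linear k A X c a 0; rewrite addr0 => ->.
by rewrite add_lfunE scale_lfunE mact0 addr0.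
Qed.

Lemma mact_sum X I (r : seq I) F x :
  mact X (\sum_(i <- r) F i) x = \sum_(i <- r) mact X (F i) x.
Proof.
elim: r => [|i r IH]; first by rewrite !big_nil mact0.
by rewrite !big_cons mactD IH.
Qed.

Lemma is_hom_id X : is_hom (\1%VF : 'End(X)).
Proof. by move=> a x; rewrite !id_lfunE. Qed.

Lemma is_homD X Y (f g : 'Hom(X, Y)) : is_hom f -> is_hom g -> is_hom (f + g).
Proof. by move=> hf hg a x; rewrite !add_lfunE hf hg linearD. Qed.

Lemma is_hom0 X Y : is_hom (0 : 'Hom(X, Y)).
Proof. by move=> a x; rewrite !zero_lfunE linear0. Qed.

Lemma is_homZ X Y c (f : 'Hom(X, Y)) : is_hom f -> is_hom (c *: f).
Proof. by move=> hf a x; rewrite !scale_lfunE hf linearZ. Qed.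

Lemma is_homN X Y (f : 'Hom(X, Y)) : is_hom f -> is_hom (- f).
Proof. by move=> hf; rewrite -scaleN1r; apply: is_homZ. Qed.

Lemma is_homB X Y (f g : 'Hom(X, Y)) : is_hom f -> is_hom g -> is_hom (f - g).
Proof. by move=> hf hg; apply/is_homD/is_homN. Qed.

Lemma is_hom_sum X Y I (r : seq I) (F : I -> 'Hom(X, Y)) :
  (forall i, is_hom (F i)) -> is_hom (\sum_(i <- r) F i).
Proof. by move=> hF; apply: big_ind => //; [exact: is_hom0 | exact: is_homD]. Qed.

Lemma is_iso_bij X Y (f : 'Hom(X, Y)) :
  is_hom f -> injective f -> (forall y, exists x, f x = y) -> is_iso f.
Proof.
move=> hf fi fs; split=> //.
have k0 : lker f == 0%VS by apply/lker0P.
exists (f^-1)%VF; first exact: lker0_compVf.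
apply/lfunP=> y; rewrite comp_lfunE id_lfunE.
by have [x <-] := fs y; rewrite lker0_lfunK.
Qed.

Lemma is_iso_endo X (f : 'End(X)) : is_hom f -> injective f -> is_iso f.
Proof.
move=> hf fi; have k0 : lker f == 0%VS by apply/lker0P.
by apply: is_iso_bij => // y; exists (f^-1 y)%VF; rewrite lker0_lfunVK.
Qed.

Lemma is_iso_inj X Y (f : 'Hom(X, Y)) : is_iso f -> injective f.
Proof.
case=> _ [g gf _] x y fxy.
by rewrite -[x](id_lfunE) -gf comp_lfunE fxy -comp_lfunE gf id_lfunE.
Qed.

Lemma is_iso_surj X Y (f : 'Hom(X, Y)) : is_iso f -> forall y, exists x, f x = y.
Proof.
by case=> _ [g _ fg] y; exists (g y); rewrite -comp_lfunE fg id_lfunE.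
Qed.

Lemma is_iso_comp X Y Z (g : 'Hom(Y, Z)) (f : 'Hom(X, Y)) :
  is_iso g -> is_iso f -> is_iso (g \o f)%VF.
Proof.
move=> gI fI; apply: is_iso_bij; first by apply: is_hom_comp; [case: gI | case: fI].
  by apply: (eq_inj (inj_comp (is_iso_inj gI) (is_iso_inj fI))) => x; rewrite comp_lfunE.
move=> z; have [y <-] := is_iso_surj gI z; have [x <-] := is_iso_surj fI y.
by exists x; rewrite comp_lfunE.
Qed.

Lemma is_iso_inverse X Y (f : 'Hom(X, Y)) : is_iso f ->
  exists g : 'Hom(Y, X), [/\ is_iso g, (g \o f = \1)%VF & (f \o g = \1)%VF].
Proof.
case=> hf [g gf fg]; exists g; split=> //; split; first exact: is_hom_inv hf gf fg.
by exists f.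
Qed.

(** * Submodules as modules in their own right *)

Section Submodule.
Variables (X : amod A) (U : {vspace X}).
Hypothesis sU : submodule U.

Definition sub_incl : 'Hom(subvs_of U, X) := linfun vsval.
Definition sub_proj : 'Hom(X, subvs_of U) := linfun (vsproj U).

Lemma sub_inclE u : sub_incl u = vsval u. Proof. by rewrite lfunE. Qed.
Lemma sub_projK x : x \in U -> sub_incl (sub_proj x) = x.
Proof. by move=> xU; rewrite !lfunE /= vsprojK. Qed.

(** [sub_proj] is only a linear retraction onto [U]; stability of [U] makes this compression the
    restricted action. *)
Definition sub_act (a : A) : 'End(subvs_of U) := (sub_proj \o mact X a \o sub_incl)%VF.

Lemma mact_sub a x : x \in U -> mact X a x \in U.
Proof. by move=> xU; apply: (subvP (sU a)); apply: memv_img. Qed.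

Lemma sub_actE a u : sub_incl (sub_act a u) = mact X a (sub_incl u).
Proof.
by rewrite !comp_lfunE sub_projK // mact_sub // sub_inclE subvsP.
Qed.

Lemma sub_incl_inj : injective sub_incl.
Proof. by move=> u v; rewrite !sub_inclE; apply: val_inj. Qed.

Fact sub_act_linear : linear sub_act.
Proof.
move=> c a b; apply/lfunP=> u; apply: sub_incl_inj.
rewrite sub_actE add_lfunE scale_lfunE linearD linearZ /= !sub_actE.
by rewrite mactD mactZ.
Qed.
Fact sub_act1 : sub_act 1 = \1%VF.
Proof. by apply/lfunP=> u; apply: sub_incl_inj; rewrite sub_actE mact1 !id_lfunE. Qed.
Fact sub_actM a b : sub_act (a * b) = (sub_act a \o sub_act b)%VF.
Proof.
apply/lfunP=> u; apply: sub_incl_inj.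
by rewrite comp_lfunE !sub_actE mactM comp_lfunE.
Qed.

Definition submod : amod A := @AMod k A (subvs_of U) sub_act sub_act_linear sub_act1 sub_actM.

Lemma sub_incl_hom : @is_hom k A submod X sub_incl.
Proof. by move=> a u; rewrite -sub_actE. Qed.

Lemma sub_proj_hom Y (f : 'Hom(Y, X)) :
  is_hom f -> (forall y, f y \in U) -> @is_hom k A Y submod (sub_proj \o f)%VF.
Proof.
move=> hf fU a y; apply: sub_incl_inj.
by rewrite [in RHS]sub_actE !comp_lfunE !sub_projK.
Qed.

End Submodule.

Lemma submodule_limg X Y (f : 'Hom(X, Y)) : is_hom f -> submodule (limg f).
Proof.
move=> hf a; apply/subvP=> _ /memv_imgP[_ /memv_imgP[x _ ->] ->].
by rewrite -hf memv_img ?memvf.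
Qed.

Lemma submodule_lker X Y (f : 'Hom(X, Y)) : is_hom f -> submodule (lker f).
Proof.
move=> hf a; apply/subvP=> _ /memv_imgP[x + ->].
by rewrite !memv_ker hf => /eqP ->; rewrite linear0.
Qed.

(** If [x = u + v] along [U] and [V], then [a u] and [a v] stay in their summands, so [a u] is the
    [U]-component of [a x]. *)
Lemma daddv_pi_hom X (U V : {vspace X}) : submodule U -> submodule V ->
  (U + V)%VS = fullv -> (U :&: V)%VS = 0%VS -> is_hom (daddv_pi U V).
Proof.
move=> sU sV UV UV0 a x.
have VU0 : (V :&: U)%VS = 0%VS by rewrite capvC.
have xE y : y = daddv_pi U V y + daddv_pi V U y.
  by rewrite daddv_pi_add // UV memvf.
have sub_pi (W W' : {vspace X}) : submodule W -> mact X a (daddv_pi W W' x) \in W.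
  by move=> sW; apply: mact_sub => //; exact: memv_pi.
have piV v : v \in V -> daddv_pi U V v = 0.
  by move=> vV; have := xE v; rewrite (daddv_pi_id VU0 vV) -[LHS]add0r => /addIr.
rewrite {1}(xE x) linearD linearD /= [X in X + _](daddv_pi_id UV0) ?sub_pi //.
by rewrite [X in _ + X]piV ?addr0 // sub_pi.
Qed.

(** The splitting object is the image of [e]; the dimension clause serves the induction in
    [indecomposable_summand]. *)
Lemma idempotent_factor Y (e : 'End(Y)) : is_hom e -> (e \o e = e)%VF ->
  exists Z (i : 'Hom(Z, Y)) (pi : 'Hom(Y, Z)),
    [/\ is_hom i, is_hom pi, (pi \o i = \1)%VF, (i \o pi = e)%VF
      & \dim {:Z} = \dim (limg e)].
Proof.
move=> he ee; have sU := submodule_limg he.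
have eU y : e y \in limg e by rewrite memv_img ?memvf.
exists (submod sU), (sub_incl (limg e)), (sub_proj (limg e) \o e)%VF; split.
- exact: sub_incl_hom.
- exact: sub_proj_hom.
- apply/lfunP=> u; apply: sub_incl_inj.
  rewrite id_lfunE !comp_lfunE sub_projK //.
  have : sub_incl (limg e) u \in limg e by rewrite sub_inclE subvsP.
  by case/memv_imgP=> y _ ->; rewrite -comp_lfunE ee.
- by apply/lfunP=> y; rewrite !comp_lfunE sub_projK.
- by rewrite dimvf.
Qed.

Lemma indecomposable_idempotent X (e : 'End(X)) :
  indecomposable X -> is_hom e -> (e \o e = e)%VF -> e = 0 \/ e = \1%VF.
Proof.
move=> [_ Xi] he ee.
have eeE x : e (e x) = e x by rewrite -comp_lfunE ee.
have UV : (limg e + lker e)%VS = fullv.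
  apply/eqP; rewrite eqEsubv subvf; apply/subvP=> y _.
  rewrite -[y](subrK (e y)) addrC memv_add ?memv_img ?memvf //.
  by rewrite memv_ker linearB /= eeE subrr.
have UV0 : (limg e :&: lker e)%VS = 0%VS.
  apply/eqP; rewrite -subv0; apply/subvP=> y.
  rewrite memv_cap memv_ker => /andP[/memv_imgP[x _ ->]].
  by rewrite eeE => /eqP ->; rewrite mem0v.
have [U0 | V0] := Xi _ _ (submodule_limg he) (submodule_lker he) UV UV0; [left|right].
  apply/lfunP=> x; apply/eqP; rewrite zero_lfunE -memv0 -U0.
  by rewrite memv_img ?memvf.
apply/lfunP=> x; apply/eqP; rewrite id_lfunE -subr_eq0 -memv0 -V0 memv_ker.
by rewrite linearB /= eeE subrr.
Qed.

(** Induction on dimension: a proper decomposition yields an idempotent with nonzero, strictly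
    smaller image. Since [rad] is tested on indecomposable modules, this supplies the test
    objects. *)
Lemma indecomposable_summand Y : {:Y}%VS <> 0%VS ->
  exists Z (i : 'Hom(Z, Y)) (pi : 'Hom(Y, Z)),
    [/\ indecomposable Z, is_hom i, is_hom pi & (pi \o i = \1)%VF].
Proof.
have [d] := ubnP (\dim {:Y}); elim: d Y => // d IH Y dY Y0.
have [Yi|nYi] := classic (indecomposable Y).
  by exists Y, \1%VF, \1%VF; split=> //; rewrite ?comp_lfun1l //; exact: is_hom_id.
have [e [he ee e0 e1]] : exists e : 'End(Y),
    [/\ is_hom e, (e \o e = e)%VF, e <> 0 & limg e <> fullv].
  apply: NNPP => ne; apply: nYi; split=> // U V sU sV UV UV0.
  have he := daddv_pi_hom sU sV UV UV0.
  have [|U0] := classic (U = 0%VS); first by left.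
  right; apply: NNPP => V0; apply: ne; exists (daddv_pi U V); split=> //.
  - by apply/lfunP=> y; rewrite comp_lfunE daddv_pi_proj.
  - move=> pi0; apply: U0; apply/eqP; rewrite -subv0; apply/subvP=> u uU.
    by rewrite -(daddv_pi_id UV0 uU) pi0 zero_lfunE mem0v.
  - move=> pi1; apply: V0; apply/eqP; rewrite -UV0; apply/eqP/esym/capv_idPr.
    rewrite (subv_trans (subvf _)) // -pi1; apply/subvP=> _ /memv_imgP[y _ ->].
    exact: memv_pi.
have [Y' [i [pi [hi hpi pii ipi dY']]]] := idempotent_factor he ee.
have [||Z [i' [pi' [Zi hi' hpi' pii']]]] := IH Y'.
- rewrite dY' (leq_trans _ (_ : \dim {:Y} <= d)%N) //.
  by rewrite (ltn_leqif (dimv_leqif_eq (subvf _))); apply/eqP.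
- move=> Y'0; apply: e0; rewrite -ipi; apply/lfunP=> y.
  have : pi y \in {:Y'}%VS by rewrite memvf.
  by rewrite Y'0 memv0 comp_lfunE => /eqP ->; rewrite linear0 zero_lfunE.
exists Z, (i \o i')%VF, (pi' \o pi)%VF; split=> //; [exact: is_hom_comp..|].
by rewrite comp_lfunA -[(pi' \o pi \o i)%VF]comp_lfunA pii comp_lfun1r.
Qed.

(** * Powers of an endomorphism and Fitting decompositions *)

Definition lfun_exp Y (f : 'End(Y)) (m : nat) : 'End(Y) :=
  iter m (fun g => f \o g)%VF \1%VF.

Lemma lfun_expE Y (f : 'End(Y)) m y : lfun_exp f m y = iter m f y.
Proof. by elim: m => [|m IH] /=; rewrite ?id_lfunE // comp_lfunE IH. Qed.

Lemma lfun_exp_hom Y (f : 'End(Y)) m : is_hom f -> is_hom (lfun_exp f m).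
Proof. by move=> hf; elim: m => [|m IH]; [exact: is_hom_id | exact: is_hom_comp]. Qed.

Lemma iter_lfun0 Y (f : 'End(Y)) m : iter m f 0 = 0.
Proof. by rewrite -lfun_expE linear0. Qed.

(** Otherwise the kernels of the powers of [f] would grow strictly without end in a
    finite-dimensional space. *)
Lemma iter_ker_stable Y (f : 'End(Y)) : exists m, forall y d,
  iter (d + m) f y = 0 -> iter m f y = 0.
Proof.
suff [m Km] : exists m, (lker (lfun_exp f m.+1) <= lker (lfun_exp f m))%VS.
  exists m => y; elim=> // d IH Ky; apply: IH.
  have : iter d f y \in lker (lfun_exp f m.+1).
    by rewrite memv_ker lfun_expE -iterD addSnnS addnC in Ky *; apply/eqP.
  by move/(subvP Km); rewrite memv_ker lfun_expE -iterD addnC => /eqP.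
apply: NNPP => nK.
have dimK m : (m <= \dim (lker (lfun_exp f m)))%N.
  elim: m => // m IH; apply: leq_ltn_trans IH _.
  have sK : (lker (lfun_exp f m) <= lker (lfun_exp f m.+1))%VS.
    by apply/subvP=> y; rewrite !memv_ker /= comp_lfunE => /eqP ->; rewrite linear0.
  rewrite (ltn_leqif (dimv_leqif_sup sK)); apply/negP => Km; apply: nK.
  by exists m.
have := leq_trans (dimK (\dim {:Y}).+1) (dimvS (subvf _)).
by rewrite ltnn.
Qed.

(* Fitting's lemma: [e] is the projection onto the generalized kernel of [f]
   along the stable image of [f]. *)
Lemma fitting Y (f : 'End(Y)) : is_hom f ->
  exists (d : nat) (e : 'End(Y)),
    [/\ is_hom e, (e \o e = e)%VF, forall x, iter d f (e x) = 0
      & forall x, f x = 0 -> e x = x].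
Proof.
move=> hf; have [m Km] := iter_ker_stable f.
(* [d] is positive even when [m = 0], so that [F = f^d] kills the kernel of [f]. *)
set d := m.+1; have [F FE] : exists F : 'End(Y), F = lfun_exp f d by eexists.
set FF := (F \o F)%VF.
have FFE z : FF z = F (F z) by rewrite comp_lfunE.
have hF : is_hom F by rewrite FE; exact: lfun_exp_hom.
have kF z : FF z = 0 -> F z = 0.
  rewrite FFE FE !lfun_expE -iterD /d addnS -addSn => /Km Fz.
  by rewrite iterS Fz linear0.
have imF y : F y \in limg FF.
  suff -> : limg FF = limg F by rewrite memv_img ?memvf.
  apply/eqP; rewrite eqEdim limg_comp limgS ?subvf //=.
  rewrite -limg_comp -(leq_add2l (\dim (lker FF))).
  have := limg_ker_dim FF fullv; rewrite capfv => ->.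
  rewrite -(limg_ker_dim F fullv) capfv leq_add2r dimvS //.
  by apply/subvP=> z; rewrite !memv_ker => /eqP/kF ->.
(* [F] and [F^2] have the same kernel and image, so [F y = F^2 z] is solvable and determines [F z].
   [P] maps [y] to [F z]: it projects onto the image of [F] along its kernel. *)
pose P : 'End(Y) := (F \o FF^-1 \o F)%VF.
have PE y z : FF z = F y -> P y = F z.
  move=> zy; rewrite !comp_lfunE; apply/eqP; rewrite -subr_eq0.
  have := kF (FF^-1%VF (F y) - z); rewrite !linearB /= limg_lfunVK // zy subrr.
  by move=> ->.
have PP y : {z | FF z = F y & P y = F z}.
  by exists (FF^-1 (F y))%VF; rewrite ?limg_lfunVK // !comp_lfunE.
have PF z : P (F z) = F z by apply: PE; rewrite FFE.
have PPE y : P (P y) = P y by have [z _ ->] := PP y; exact: PF.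
have FP y : F (P y) = F y by have [z <- ->] := PP y; rewrite FFE.
exists d, (\1 - P)%VF; split.
- apply: is_homB; first exact: is_hom_id.
  by move=> a y; have [z zy ->] := PP y; rewrite -hF; apply: PE; rewrite FFE !hF -FFE zy.
- apply/lfunP=> y; rewrite comp_lfunE !add_lfunE !opp_lfunE !id_lfunE linearB /=.
  by rewrite PPE subrr subr0.
- by move=> y; rewrite -lfun_expE -FE add_lfunE opp_lfunE id_lfunE linearB /= FP subrr.
move=> y fy; have Fy : F y = 0 by rewrite FE lfun_expE /d iterSr fy iter_lfun0.
have Py : P y = 0 by rewrite (PE y 0) ?linear0.
by rewrite add_lfunE opp_lfunE id_lfunE Py subr0.
Qed.

(** The hypothesis applies to the Fitting projection; once this is zero, [f] is injective. Both
    [rad_sub1] and right minimality rest on this criterion. *)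
Lemma fitting_iso Y (f : 'End(Y)) : is_hom f ->
  (forall (e : 'End(Y)) d, is_hom e -> (e \o e = e)%VF ->
     (forall x, iter d f (e x) = 0) -> e = 0) -> is_iso f.
Proof.
move=> hf fe; have [d [e [he ee ef ke]]] := fitting hf.
have e0 := fe e d he ee ef.
apply: is_iso_endo => //; apply/lker0P; rewrite -subv0; apply/subvP=> x.
by rewrite memv_ker memv0 => /eqP/ke <-; rewrite e0 zero_lfunE.
Qed.

End AlgebraModules.

(** * The radical and almost split sequences *)

Section Radical.
Variables (k : fieldType) (A : falgType k).
Implicit Types X Y Z E L M : amod A.

Lemma is_iso_zero X Y (f : 'Hom(X, Y)) : indecomposable X -> is_iso f -> f <> 0.
Proof.
move=> [X0 _] fI f0; apply: X0; apply/eqP; rewrite -subv0; apply/subvP=> x _.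
by rewrite memv0; apply/eqP/(is_iso_inj fI); rewrite f0 !zero_lfunE.
Qed.

(** With [u] inverse to [f + g], the Fitting idempotent of [u f] is 0 or 1. If it is 0, [f] is
    injective. If it is 1, [u f] is nilpotent but fixes the kernel of [g], so [g] is injective. *)
Lemma indecomposable_local Z (f g : 'End(Z)) : indecomposable Z ->
  is_hom f -> is_hom g -> is_iso (f + g) -> is_iso f \/ is_iso g.
Proof.
move=> Zi hf hg /is_iso_inverse[u [[hu _] u1 u2]].
have [d [e [he ee nile ke]]] := fitting (is_hom_comp hu hf).
have uE x : u (f x) + u (g x) = x.
  by rewrite -linearD /= -add_lfunE -comp_lfunE u1 id_lfunE.
have u_inj x : u x = 0 -> x = 0.
  by move=> ux; rewrite -[x](id_lfunE) -u2 comp_lfunE ux linear0.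
have [e0|e1] := indecomposable_idempotent Zi he ee; [left|right].
  apply: is_iso_endo => //; apply/lker0P; rewrite -subv0; apply/subvP=> x.
  rewrite memv_ker memv0 => /eqP fx.
  by rewrite -(ke x) ?e0 ?zero_lfunE // comp_lfunE fx linear0.
apply: is_iso_endo => //; apply/lker0P; rewrite -subv0; apply/subvP=> x.
rewrite memv_ker memv0 => /eqP gx.
have fix_x : (u \o f)%VF x = x by rewrite comp_lfunE -[RHS]uE gx linear0 addr0.
have := nile x; rewrite e1 id_lfunE => <-; apply/eqP.
by elim: d {nile} => // d IH; rewrite iterSr fix_x.
Qed.

Lemma rad_hom X Y (f : 'Hom(X, Y)) : rad f -> is_hom f.
Proof. by case. Qed.

Lemma rad0 X Y : rad (0 : 'Hom(X, Y)).
Proof.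
split=> [|Z g h Zi _ _ gI]; first exact: is_hom0.
by apply: (is_iso_zero Zi gI); rewrite comp_lfun0r comp_lfun0l.
Qed.

Lemma radD X Y (f g : 'Hom(X, Y)) : rad f -> rad g -> rad (f + g).
Proof.
move=> [hf rf] [hg rg]; split=> [|Z u v Zi hu hv]; first exact: is_homD.
rewrite comp_lfunDr comp_lfunDl => /(indecomposable_local Zi).
by case; [do 2![apply: is_hom_comp => //].. | exact: rf | exact: rg].
Qed.

Lemma rad_sum X Y I (r : seq I) (F : I -> 'Hom(X, Y)) :
  (forall i, rad (F i)) -> rad (\sum_(i <- r) F i).
Proof. by move=> hF; apply: big_ind => //; [exact: rad0 | exact: radD]. Qed.

Lemma rad_compl X Y Z (f : 'Hom(X, Y)) (u : 'Hom(Y, Z)) :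
  rad f -> is_hom u -> rad (u \o f)%VF.
Proof.
move=> [hf rf] hu; split=> [|W g h Wi hg hh]; first exact: is_hom_comp.
by rewrite comp_lfunA; apply: rf => //; exact: is_hom_comp.
Qed.

Lemma rad_compr X Y Z (f : 'Hom(Y, Z)) (u : 'Hom(X, Y)) :
  rad f -> is_hom u -> rad (f \o u)%VF.
Proof.
move=> [hf rf] hu; split=> [|W g h Wi hg hh]; first exact: is_hom_comp.
by rewrite comp_lfunA -comp_lfunA; apply: rf => //; exact: is_hom_comp.
Qed.

Lemma radZ X Y c (f : 'Hom(X, Y)) : rad f -> rad (c *: f).
Proof.
move=> rf; rewrite -[f]comp_lfun1l comp_lfunZl; apply: rad_compl => //.
exact/is_homZ/is_hom_id.
Qed.

Lemma radN X Y (f : 'Hom(X, Y)) : rad f -> rad (- f).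
Proof. by rewrite -scaleN1r; exact: radZ. Qed.

(** If [1 - w] were nilpotent on a nonzero summand, the identity of an indecomposable summand there
    would factor through [w]. *)
Lemma rad_sub1 Y (w : 'End(Y)) : rad w -> is_iso (\1 - w)%VF.
Proof.
move=> [hw rw]; set f := (\1 - w)%VF.
have hf : is_hom f by apply: is_homB => //; exact: is_hom_id.
apply: fitting_iso => // e d he ee nile; apply: NNPP => e0.
have fE x : f x = x - w x by rewrite add_lfunE opp_lfunE id_lfunE.
(* [u = 1 + f + ... + f^(d-1)]; since [w = 1 - f], the product [u w] telescopes to [1 - f^d]. *)
have [u hu uw] : exists2 u : 'End(Y), is_hom u & forall x, u (w x) = x - iter d f x.
  elim: (d) => [|m [u hu uw]].
    by exists 0; [exact: is_hom0 | move=> x; rewrite zero_lfunE subrr].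
  exists (u + lfun_exp f m); first by apply: is_homD => //; exact: lfun_exp_hom.
  move=> x; rewrite add_lfunE uw lfun_expE iterSr fE.
  by rewrite -!lfun_expE linearB opprB addrA addrAC.
have [Y' [i0 [pi0 [hi0 hpi0 pii0 ipi0 _]]]] := idempotent_factor he ee.
have [|Z [i [pi [Zi hi hpi pii]]]] := @indecomposable_summand _ _ Y'.
  move=> Y'0; apply: e0; rewrite -ipi0; apply/lfunP=> y.
  have : pi0 y \in {:Y'}%VS by rewrite memvf.
  by rewrite Y'0 memv0 comp_lfunE => /eqP ->; rewrite linear0 zero_lfunE.
apply: (rw Z (i0 \o i) (pi \o pi0 \o u) Zi)%VF; [exact: is_hom_comp..| | ].
  by apply: is_hom_comp => //; exact: is_hom_comp.
have -> : (pi \o pi0 \o u \o w \o (i0 \o i) = \1)%VF.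
  apply/lfunP=> z; rewrite !comp_lfunE uw.
  have i0E y : i0 y = e (i0 y).
    by rewrite -ipi0 comp_lfunE -[pi0 (i0 y)]comp_lfunE pii0 id_lfunE.
  rewrite {2}i0E nile subr0 -[pi0 _]comp_lfunE pii0 id_lfunE.
  by rewrite -comp_lfunE pii.
by apply: is_iso_endo; [exact: is_hom_id | move=> x y; rewrite !id_lfunE].
Qed.

(** A section of [h] would make the identity of an indecomposable summand of [M] factor through
    [h]. *)
Lemma rad_not_split_epi Y M (h : 'Hom(Y, M)) :
  {:M}%VS <> 0%VS -> rad h -> ~ split_epi h.
Proof.
move=> M0 [hh rh] [g hg hg1].
have [Z [i [pi [Zi hi hpi pii]]]] := indecomposable_summand M0.
apply: (rh Z (g \o i)%VF pi Zi) => //; first exact: is_hom_comp.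
rewrite comp_lfunA -(comp_lfunA pi) hg1 comp_lfun1r pii.
by apply: is_iso_endo; [exact: is_hom_id | move=> x y; rewrite !id_lfunE].
Qed.

Lemma right_almost_split_neq0 E M (p : 'Hom(E, M)) :
  right_almost_split p -> {:M}%VS <> 0%VS.
Proof.
move=> [hp np _] M0; apply: np; exists 0; first exact: is_hom0.
apply/lfunP=> x; apply/eqP; rewrite comp_lfun0r zero_lfunE id_lfunE eq_sym -memv0.
by rewrite -M0 memvf.
Qed.

(* If [i] inverts [h \o p \o g], then [e = p \o g \o i \o h] is idempotent.  It
   factors through [p], so [1 - e] does not and is a split epimorphism; hence [e = 0]. *)
Lemma right_almost_split_rad E M (p : 'Hom(E, M)) : right_almost_split p -> rad p.
Proof.
move=> [hp np lp]; split=> // Z g h Zi hg hh hpg.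
have [i [[hi _] i1 i2]] := is_iso_inverse hpg.
set t := (g \o i \o h)%VF.
have ht : is_hom t by do 2!apply: is_hom_comp => //.
have iE z : i (h (p (g z))) = z by have := congr1 (fun f : 'End(Z) => f z) i1; rewrite !comp_lfunE id_lfunE.
have ptp z : p (t (p (g z))) = p (g z) by rewrite !comp_lfunE iE.
have [[s hs s1]|ns] := classic (split_epi (\1 - (p \o t))%VF); last first.
  have [|t' ht' tE] := lp M (\1 - (p \o t))%VF _ ns.
    by apply: is_homB; [exact: is_hom_id | exact: is_hom_comp].
  apply: np; exists (t + t'); first exact: is_homD.
  by rewrite comp_lfunDr -tE addrC subrK.
apply: (is_iso_zero Zi hpg); apply/lfunP=> z; rewrite zero_lfunE !comp_lfunE.
(* Every [m] is [(1 - e) (s m)], and [e (1 - e) = 0]. *)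
have pt m : p (t m) = 0.
  have tE x : t x = g (i (h x)) by rewrite !comp_lfunE.
  have sE : s m - p (t (s m)) = m.
    have := congr1 (fun f : 'End(M) => f m) s1.
    by rewrite comp_lfunE add_lfunE opp_lfunE comp_lfunE !id_lfunE.
  by rewrite -sE !linearB /= [t (s m)]tE ptp subrr.
by rewrite -ptp pt linear0.
Qed.

(** The image of [e] lies in [ker p = im i], so [e = i s], and [f = s i] is idempotent. If [f] is
    split mono, it is 1 and [s] splits [i]; if [1 - f] is, then [f = 0] and [e = 0]. Otherwise [f]
    and [1 - f] both extend along [i], and so does their sum 1, which again splits [i]. *)
Lemma almost_split_idempotent L E M (i : 'Hom(L, E)) (p : 'Hom(E, M)) (e : 'End(E)) :
  almost_split_exact i p -> is_hom e -> (e \o e = e)%VF -> (p \o e)%VF = 0 -> e = 0.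
Proof.
move=> [[hi hp i0 ip _] [_ ni li] _] he ee pe.
have i_inj : injective i by apply/lker0P/eqP.
pose s : 'Hom(E, L) := (i^-1 \o e)%VF.
have sE x : i (s x) = e x.
  by rewrite comp_lfunE limg_lfunVK // ip memv_ker -comp_lfunE pe zero_lfunE.
have hs : is_hom s by move=> a x; apply: i_inj; rewrite hi !sE he.
have ssE x : s (e x) = s x by apply: i_inj; rewrite !sE -comp_lfunE ee.
set f := (s \o i)%VF.
have hf : is_hom f by exact: is_hom_comp.
have fE x : f x = s (i x) by rewrite comp_lfunE.
have ffE x : f (f x) = f x by rewrite !fE sE ssE.
have [[g hg g1]|nf] := classic (split_mono f).
  have gE y : g (f y) = y by rewrite -comp_lfunE g1 id_lfunE.
  case: ni; exists s => //; apply/lfunP=> x; rewrite id_lfunE -/f.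
  by rewrite -[RHS]gE -[in RHS]ffE gE.
have [[g hg g1]|nf'] := classic (split_mono (\1 - f)%VF).
  apply/lfunP=> x; rewrite zero_lfunE -sE.
  have f0 y : f y = 0.
    rewrite -[f y](id_lfunE) -g1 comp_lfunE add_lfunE opp_lfunE id_lfunE ffE.
    by rewrite subrr linear0.
  by rewrite -ssE -sE -fE f0 linear0.
have [g hg gE] := li _ _ hf nf.
have [|g' hg' gE'] := li _ _ _ nf'; first by apply: is_homB => //; exact: is_hom_id.
case: ni; exists (g + g'); first exact: is_homD.
by rewrite comp_lfunDl -gE -gE' addrC subrK.
Qed.

(** [p = p f^d], and [f^d] vanishes on the image of a Fitting idempotent [e]; hence [p e = 0], which
    forces [e = 0]. *)
Lemma almost_split_right_minimal L E M (i : 'Hom(L, E)) (p : 'Hom(E, M)) (f : 'End(E)) :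
  almost_split_exact i p -> is_hom f -> (p \o f)%VF = p -> is_iso f.
Proof.
move=> ip hf pf; apply: fitting_iso => // e d he ee nile.
apply: (almost_split_idempotent ip he ee); apply/lfunP=> x.
rewrite comp_lfunE zero_lfunE; have <- : p (iter d f (e x)) = p (e x).
  by elim: (d) => //= m IH; rewrite -comp_lfunE pf.
by rewrite nile linear0.
Qed.

(* The radical is the Jacobson radical of the module category, so
   [p' = p \o b] and [p = p' \o b' + p \o w] give [p \o b \o b' = p \o (1 - w)]
   with [1 - w] invertible. *)
Lemma almost_split_transport L E E' M (i : 'Hom(L, E)) (p : 'Hom(E, M))
    (p' : 'Hom(E', M)) (b' : 'Hom(E, E')) (w : 'End(E)) :
  almost_split_exact i p -> rad p' -> is_hom b' -> (forall y, exists x, b' x = y) ->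
  rad w -> p = ((p' \o b') + (p \o w))%VF ->
  exists2 b : 'Hom(E', E), is_iso b & (p \o b)%VF = p'.
Proof.
move=> ip rp' hb' b'_surj rw pE; have [_ _ ras] := ip.
have nsp := rad_not_split_epi (right_almost_split_neq0 ras) rp'.
have [hp _ lift] := ras; have [b hb p'E] := lift _ _ (rad_hom rp') nsp.
exists b => //.
have [v [vI v1 v2]] := is_iso_inverse (rad_sub1 rw).
have hv : is_hom v by case: vI.
have pbb' : (p \o (b \o b') = p \o (\1 - w))%VF.
  rewrite comp_lfunA -p'E comp_lfunDr comp_lfunNr comp_lfun1r.
  by rewrite [X in X - _]pE addrK.
have fI : is_iso ((b \o b') \o v)%VF.
  apply: (almost_split_right_minimal ip); first by do 2!apply: is_hom_comp => //.
  by rewrite comp_lfunA pbb' -comp_lfunA v2 comp_lfun1r.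
have bb'I : is_iso (b \o b')%VF.
  have := is_iso_comp fI (rad_sub1 rw).
  by rewrite -comp_lfunA v1 comp_lfun1r.
(* As [b'] is onto, injectivity of [b b'] passes to [b]. *)
apply: is_iso_bij => //.
  move=> y1 y2; have [x1 <-] := b'_surj y1; have [x2 <-] := b'_surj y2.
  by rewrite -!comp_lfunE => /(is_iso_inj bb'I) ->.
by move=> y; have [x <-] := is_iso_surj bb'I y; exists (b' x); rewrite comp_lfunE.
Qed.

End Radical.

(** * Endomorphisms over an algebraically closed field *)

Lemma closed_eigenvector (k : closedFieldType) (V : vectType k) (f : 'End(V)) :
  {:V}%VS <> 0%VS -> exists c x, x != 0 /\ f x = c *: x.
Proof.
move=> V0.
have /closed_rootP[c rc] : size (char_poly (passmx.mxof (vbasis {:V}) (vbasis {:V}) f)) != 1%N.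
  by rewrite size_char_poly eqSS dimv_eq0; apply/eqP.
rewrite -eigenvalue_root_char /eigenvalue in rc.
rewrite -(passmx.vsof_eq0 (vbasisP _)) -(passmx.leigenspaceE (vbasisP _)) in rc.
exists c; have [x xf x0] : exists2 x, x \in passmx.leigenspace f c & x != 0.
  by exists (vpick (passmx.leigenspace f c)); [exact: memv_pick | rewrite vpick0].
exists x; split=> //; move: xf; rewrite memv_ker add_lfunE opp_lfunE scale_lfunE id_lfunE.
by rewrite subr_eq0 => /eqP.
Qed.

(** Subtracting an eigenvalue destroys injectivity, and an endomorphism of an indecomposable module
    that is not an isomorphism is radical. *)
Lemma indecomposable_scalar_rad (k : closedFieldType) (A : falgType k) (X : amod A)
    (f : 'End(X)) : indecomposable X -> is_hom f ->
  exists c, rad (f - c *: \1)%VF.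
Proof.
move=> Xi hf; have [X0 _] := Xi; have [c [x [x0 fx]]] := closed_eigenvector f X0.
exists c; apply/radE => //; split.
  by apply: is_homB => //; apply/is_homZ/is_hom_id.
move/is_iso_inj/(_ x 0); rewrite linear0 add_lfunE opp_lfunE scale_lfunE id_lfunE.
by rewrite fx subrr => /(_ erefl) x00; rewrite x00 eqxx in x0.
Qed.

(** * The Hopf algebra kG *)

Section TensorSums.
Variable k : fieldType.

Lemma linear_bigsum (U W : lmodType k) I (r : seq I) (F : I -> U -> W) :
  (forall i, linear (F i)) -> linear (fun u => \sum_(i <- r) F i u).
Proof.
move=> Flin c u v; rewrite scaler_sumr -big_split.
by apply: eq_bigr => i _; exact: Flin.
Qed.

Lemma bilinear0l (U V W : lmodType k) (b : U -> V -> W) v :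
  bilinear_for *:%R *:%R b -> b 0 v = 0.
Proof. by case=> bl _; have /= := bl v (-1) 0 0; rewrite scaler0 addr0 scaleN1r addNr. Qed.

Lemma bilinear0r (U V W : lmodType k) (b : U -> V -> W) u :
  bilinear_for *:%R *:%R b -> b u 0 = 0.
Proof. by case=> _ br; have /= := br u (-1) 0 0; rewrite scaler0 addr0 scaleN1r addNr. Qed.

Lemma bilinearZl (U V W : lmodType k) (b : U -> V -> W) c u v :
  bilinear_for *:%R *:%R b -> b (c *: u) v = c *: b u v.
Proof.
move=> bP; have [bl _] := bP; have /= := bl v c u 0.
by rewrite addr0 (bilinear0l _ bP) addr0.
Qed.

Lemma bilinear_suml (U V W : lmodType k) (b : U -> V -> W) I (r : seq I) c F v :
  bilinear_for *:%R *:%R b ->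
  b (\sum_(i <- r) c i *: F i) v = \sum_(i <- r) c i *: b (F i) v.
Proof.
move=> bP; elim: r => [|i r IH]; first by rewrite !big_nil bilinear0l.
by rewrite !big_cons -IH; have [bl _] := bP; exact: (bl v (c i) (F i)).
Qed.

Lemma bilinear_sumr (U V W : lmodType k) (b : U -> V -> W) I (r : seq I) c F u :
  bilinear_for *:%R *:%R b ->
  b u (\sum_(i <- r) c i *: F i) = \sum_(i <- r) c i *: b u (F i).
Proof.
move=> bP; elim: r => [|i r IH]; first by rewrite !big_nil bilinear0r.
by rewrite !big_cons -IH; have [_ br] := bP; exact: (br u (c i) (F i)).
Qed.

(** Any bilinear map expands in its values on pairs of basis vectors. Different factors are allowed
    because the condition defining [k[G]^N] lives in [k[G]] (x) [k[N]]. *)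
Lemma tensor_eq_coord (U V : vectType k) (s t : seq (U * V)) :
  (forall i j,
     \sum_(p <- s) coord (vbasis {:U}) i p.1 * coord (vbasis {:V}) j p.2 =
     \sum_(p <- t) coord (vbasis {:U}) i p.1 * coord (vbasis {:V}) j p.2) ->
  tensor_eq s t.
Proof.
move=> st W b bP.
have E (r : seq (U * V)) : \sum_(p <- r) b p.1 p.2 =
    \sum_(i < \dim {:U}) \sum_(j < \dim {:V})
      (\sum_(p <- r) coord (vbasis {:U}) i p.1 * coord (vbasis {:V}) j p.2)
      *: b (vbasis {:U})`_i (vbasis {:V})`_j.
  under [RHS]eq_bigr => i _ do under eq_bigr => j _ do rewrite scaler_suml.
  under [RHS]eq_bigr => i _ do rewrite exchange_big /=.
  rewrite exchange_big /=; apply: eq_bigr => p _.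
  rewrite {1}(coord_vbasis (memvf p.1)) (bilinear_suml _ _ _ _ bP).
  apply: eq_bigr => i _; rewrite {1}(coord_vbasis (memvf p.2)) (bilinear_sumr _ _ _ _ bP).
  by rewrite scaler_sumr; apply: eq_bigr => j _; rewrite scalerA.
by rewrite !E; apply: eq_bigr => i _; apply: eq_bigr => j _; rewrite st.
Qed.

End TensorSums.

Section GroupAlgebraHopf.
Variables (k : fieldType) (G : finGroupScheme k).
Local Notation kG := (galg G).
Local Notation OG := (fcoordring G).
Local Notation n := (\dim {:OG}).
Local Notation e := (vbasis {:OG}).
Implicit Types (a b : kG) (X Y : gmod G).

Lemma galgM a b x : (a * b : kG) x = \sum_(p <- comul (G := G) x) a p.1 * b p.2.
Proof. exact: galg_mulE. Qed.

Lemma galg1 x : (1 : kG) x = counit G x.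
Proof. exact: galg_oneE. Qed.

(** Evaluation at the unit of [k[G]] is the counit of [kG]; it is multiplicative because 1 is
    group-like in [k[G]]. *)
Lemma galgM_1 a b : (a * b : kG) 1 = a 1 * b 1.
Proof.
rewrite galgM; have := hcomul1 (fcoordring_hopf G) (conv_bilinear a b).
by rewrite big_seq1.
Qed.

Lemma galg1_1 : (1 : kG) 1 = 1.
Proof. by rewrite galg1 rmorph1. Qed.

Lemma sum_gcomul_dual (W : lmodType k) (F : kG -> kG -> W) a :
  bilinear_for *:%R *:%R F ->
  \sum_(p <- gcomul a) F p.1 p.2 =
  \sum_(i < n) \sum_(j < n) a (e`_i * e`_j) *: F (dual_basis i) (dual_basis j).
Proof.
move=> FP; rewrite sum_gcomul.
by apply: eq_bigr => i _; apply: eq_bigr => j _; rewrite (bilinearZl _ _ _ FP).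
Qed.

Lemma trilinear_bilinear1 (U W : lmodType k) (t : U -> U -> U -> W) w :
  trilinear t -> @bilinear_for k U U W *:%R *:%R (fun u v => t u v w).
Proof. by case=> t1 t2 t3; split=> v; [exact: t1 | exact: t2]. Qed.

Lemma trilinear_bilinear2 (U W : lmodType k) (t : U -> U -> U -> W) u :
  trilinear t -> @bilinear_for k U U W *:%R *:%R (fun v w => t u v w).
Proof. by case=> t1 t2 t3; split=> v; [exact: t2 | exact: t3]. Qed.

(** Dual to associativity of [k[G]]: in the dual basis the coefficients are the values of [a] on the
    two bracketings of [e_i e_j e_l]. *)
Lemma gcomulA a (W : lmodType k) (t : kG -> kG -> kG -> W) : trilinear t ->
  \sum_(p <- gcomul a) \sum_(q <- gcomul p.1) t q.1 q.2 p.2 =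
  \sum_(p <- gcomul a) \sum_(q <- gcomul p.2) t p.1 q.1 q.2.
Proof.
move=> tP; have [t1 t2 t3] := tP.
set d := @dual_basis k G.
have E1 : \sum_(p <- gcomul a) \sum_(q <- gcomul p.1) t q.1 q.2 p.2 =
    \sum_(i < n) \sum_(j < n) \sum_(l < n) a (e`_i * e`_j * e`_l) *: t (d i) (d j) (d l).
  rewrite (sum_gcomul (fun u v => \sum_(q <- gcomul u) t q.1 q.2 v)) exchange_big /=.
  under eq_bigr => l _ do under eq_bigr => m _ do
    rewrite (sum_gcomul_dual _ (trilinear_bilinear1 _ tP)).
  under eq_bigr => l _.
    rewrite exchange_big /=.
    under eq_bigr => i _ do rewrite exchange_big /=.
    over.
  rewrite exchange_big /=; apply: eq_bigr => i _.
  rewrite exchange_big /=; apply: eq_bigr => j _; apply: eq_bigr => l _.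
  rewrite -scaler_suml; congr (_ *: _).
  rewrite [in RHS](basis_expand (e`_i * e`_j)) mulr_suml galg_sum.
  apply: eq_bigr => m _; rewrite galgZ dual_basisE -scalerAl galg_scale.
  by rewrite mulrC.
have E2 : \sum_(p <- gcomul a) \sum_(q <- gcomul p.2) t p.1 q.1 q.2 =
    \sum_(i < n) \sum_(j < n) \sum_(l < n) a (e`_i * (e`_j * e`_l)) *: t (d i) (d j) (d l).
  rewrite (sum_gcomul (fun u v => \sum_(q <- gcomul v) t u q.1 q.2)).
  apply: eq_bigr => i _.
  under eq_bigr => m _ do rewrite (sum_gcomul_dual _ (trilinear_bilinear2 _ tP)).
  rewrite exchange_big /=; apply: eq_bigr => j _.
  rewrite exchange_big /=; apply: eq_bigr => l _.
  under eq_bigr => m _ do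
    rewrite (bilinearZl _ _ _ (trilinear_bilinear1 _ tP)) scalerA.
  rewrite -scaler_suml; congr (_ *: _).
  rewrite [in RHS](basis_expand (e`_j * e`_l)) mulr_sumr galg_sum.
  by apply: eq_bigr => m _; rewrite dual_basisE -scalerAr galg_scale.
rewrite E1 E2; apply: eq_bigr => i _; apply: eq_bigr => j _; apply: eq_bigr => l _.
by rewrite mulrA.
Qed.

(** Dual to commutativity of [k[G]]. *)
Lemma gcomulC a : tensor_eq (gcomul a) [seq (p.2, p.1) | p <- gcomul a].
Proof.
apply: tensor_eq_galg => x y; rewrite big_map /= gcomulE (hopf_mulC (fcoordring_hopf G)).
by rewrite -gcomulE; apply: eq_bigr => p _; rewrite mulrC.
Qed.

Lemma gcounitl a : \sum_(p <- gcomul a) (p.1 : kG) 1 *: p.2 = a.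
Proof.
apply: galgP => x; rewrite galg_sumf -[in RHS](mul1r x) -gcomulE.
by apply: eq_bigr => p _; rewrite galgZ.
Qed.

Lemma gcounitr a : \sum_(p <- gcomul a) (p.2 : kG) 1 *: p.1 = a.
Proof.
apply: galgP => x; rewrite galg_sumf -[in RHS](mulr1 x) -gcomulE.
by apply: eq_bigr => p _; rewrite galgZ mulrC.
Qed.

Lemma gantipE a x : gantip a x = a (antip G x).
Proof. by rewrite /galg_fun /gantip lfunE. Qed.

Lemma gantip_linear : linear (@gantip k G).
Proof. by move=> c a b; apply: galgP => x; rewrite galgD galgZ !gantipE galgD galgZ. Qed.

Lemma gantipl a : \sum_(p <- gcomul a) gantip p.1 * p.2 = a 1 *: 1.
Proof.
apply: galgP => x; rewrite galg_sumf galgZ galg1.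
under eq_bigr => p _ do (rewrite galgM; under eq_bigr => r _ do rewrite gantipE).
rewrite exchange_big /=; under eq_bigr => r _ do rewrite gcomulE.
rewrite -galg_sum (hantipl (fcoordring_hopf G)) galg_scale mulrC.
by [].
Qed.

Lemma gantipr a : \sum_(p <- gcomul a) p.1 * gantip p.2 = a 1 *: 1.
Proof.
apply: galgP => x; rewrite galg_sumf galgZ galg1.
under eq_bigr => p _ do (rewrite galgM; under eq_bigr => r _ do rewrite gantipE).
rewrite exchange_big /=; under eq_bigr => r _ do rewrite gcomulE.
rewrite -galg_sum (hantipr (fcoordring_hopf G)) galg_scale mulrC.
by [].
Qed.

Lemma gantip1 : gantip (1 : kG) = 1.
Proof.
have FP : @bilinear_for k kG kG kG *:%R *:%R (fun u v => u * gantip v).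
  split=> u c x y /=; first by rewrite mulrDl scalerAl.
  by rewrite gantip_linear mulrDr scalerAr.
have := gantipr 1; rewrite (gcomul1 FP) big_seq1 mul1r => ->.
by rewrite galg1_1 scale1r.
Qed.

(* Right convolution with the antipode inverts right convolution with the identity. *)
Lemma convolution_antipode (F H : kG -> kG) a : linear F ->
  (forall b, \sum_(p <- gcomul b) F p.1 * p.2 = H b) ->
  F a = \sum_(p <- gcomul a) H p.1 * gantip p.2.
Proof.
move=> Flin FH.
have tP : @trilinear k kG kG (fun u v w => F u * v * gantip w).
  split=> u v c x y /=.
  - by rewrite Flin !mulrDl -!scalerAl.
  - by rewrite mulrDr !mulrDl -scalerAr -scalerAl.
  - by rewrite gantip_linear mulrDr -scalerAr.
under eq_bigr => p _ do rewrite -FH mulr_suml.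
rewrite (gcomulA a tP).
under eq_bigr => p _.
  under eq_bigr => q _ do rewrite -mulrA.
  rewrite -mulr_sumr gantipr -scalerAr mulr1.
  over.
have FZ c x : F (c *: x) = c *: F x.
  have F0 : F 0 = 0 by have := Flin (-1) 0 0; rewrite scaler0 addr0 scaleN1r addNr.
  by have := Flin c x 0; rewrite F0 !addr0.
rewrite -{1}(gcounitr a); elim/big_rec2: _ => [|p x y _ <-].
  by have := FZ 0 0; rewrite !scale0r.
exact: Flin.
Qed.

Lemma gantip0 : gantip (0 : kG) = 0.
Proof. by have := gantip_linear (-1) 0 0; rewrite scaler0 addr0 scaleN1r addNr. Qed.

Lemma gantipZ c a : gantip (c *: a) = c *: gantip a.
Proof. by have := gantip_linear c a 0; rewrite gantip0 !addr0. Qed.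

Lemma gantip_sum I (r : seq I) (F : I -> kG) :
  gantip (\sum_(i <- r) F i) = \sum_(i <- r) gantip (F i).
Proof.
elim: r => [|i r IH]; first by rewrite !big_nil gantip0.
by rewrite !big_cons -IH -[F i]scale1r gantip_linear !scale1r.
Qed.

(** Two convolution inversions. Since the antipode sends [a_1 b_1] against [a_2 b_2] to the counit
    of [a b], inverting in the second variable gives [step]; inverting [step] in the first variable
    gives the claim. *)
Lemma gantipM a b : gantip (a * b) = gantip b * gantip a.
Proof.
have SaP : @bilinear_for k kG kG kG *:%R *:%R (fun u v => gantip u * v).
  split=> u z x y /=; first by rewrite gantip_linear mulrDl -scalerAl.
  by rewrite mulrDr -scalerAr.
have step a' c : \sum_(p <- gcomul a') gantip (p.1 * c) * p.2 = a' 1 *: gantip c.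
  pose K (c' : kG) : kG := \sum_(p <- gcomul a') gantip (p.1 * c') * p.2.
  rewrite -/(K c) (@convolution_antipode K (fun b' => (a' 1 * b' 1) *: 1) c).
  - under eq_bigr => p _ do rewrite -scalerAl mul1r -scalerA -gantipZ.
    by rewrite -scaler_sumr -gantip_sum gcounitl.
  - apply: (@linear_bigsum k kG kG) => p z x y.
    by rewrite mulrDr -scalerAr gantip_linear mulrDl -scalerAl.
  move=> b'; rewrite -galgM_1 -gantipl (gcomulM a' b' SaP) [RHS]big_allpairs_dep /=.
  under [LHS]eq_bigr => q _ do rewrite /K mulr_suml.
  rewrite exchange_big /=.
  by under eq_bigr => p _ do under eq_bigr => q _ do rewrite -mulrA.
rewrite (@convolution_antipode (fun a' => gantip (a' * b)) (fun a' => a' 1 *: gantip b) a).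
- under eq_bigr => p _ do rewrite -scalerAl scalerAr -gantipZ.
  by rewrite -mulr_sumr -gantip_sum gcounitl.
- by move=> z x y; rewrite mulrDl -scalerAl gantip_linear.
by move=> a'; rewrite step.
Qed.
End GroupAlgebraHopf.

(** * Conjugation and averaging *)

Section Conjugation.
Variables (k : fieldType) (G : finGroupScheme k) (X Y : gmod G).
Local Notation kG := (galg G).
Implicit Types (a b : kG) (phi : 'Hom(X, Y)).

Lemma conj_actE a phi x :
  conj_act a phi x = \sum_(p <- gcomul a) mact Y p.1 (phi (mact X (gantip p.2) x)).
Proof. by rewrite sum_lfunE; apply: eq_bigr => p _; rewrite !comp_lfunE. Qed.

Lemma conj_bilinear phi x :
  @bilinear_for k kG kG Y *:%R *:%R (fun u v => mact Y u (phi (mact X (gantip v) x))).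
Proof.
split=> u c v w /=; first by rewrite mactD mactZ.
by rewrite gantip_linear mactD mactZ !linearP.
Qed.

Lemma conj_act_additive phi : linear (fun a => conj_act a phi).
Proof.
move=> c a b; apply/lfunP=> x; rewrite add_lfunE scale_lfunE !conj_actE.
exact: (tensor_eq_linear (@gcomul_linear k G) (conj_bilinear phi x)).
Qed.

Lemma conj_act_linear a : linear (@conj_act k G X Y a).
Proof.
move=> c phi psi; apply/lfunP=> x; rewrite add_lfunE scale_lfunE !conj_actE.
rewrite scaler_sumr -big_split; apply: eq_bigr => p _.
by rewrite add_lfunE scale_lfunE linearP.
Qed.
HB.instance Definition _ a :=
  GRing.isLinear.Build k 'Hom(X, Y) 'Hom(X, Y) *:%R (conj_act a) (conj_act_linear a).

Definition conj_lin a : 'End('Hom(X, Y)) := linfun (conj_act a).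

Lemma conj_linE a phi : conj_lin a phi = conj_act a phi.
Proof. by rewrite lfunE. Qed.

Fact conj_lin_linear : linear conj_lin.
Proof.
move=> c a b; apply/lfunP=> phi; rewrite add_lfunE scale_lfunE !conj_linE.
exact: conj_act_additive.
Qed.

Fact conj_lin1 : conj_lin 1 = \1%VF.
Proof.
apply/lfunP=> phi; rewrite conj_linE id_lfunE; apply/lfunP=> x.
rewrite conj_actE (gcomul1 (conj_bilinear phi x)) big_seq1 /=.
by rewrite gantip1 !mact1 !id_lfunE.
Qed.

Fact conj_linM a b : conj_lin (a * b) = (conj_lin a \o conj_lin b)%VF.
Proof.
apply/lfunP=> phi; rewrite comp_lfunE !conj_linE; apply/lfunP=> x.
rewrite !conj_actE (gcomulM a b (conj_bilinear phi x)) big_allpairs_dep /=.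
apply: eq_bigr => p _; rewrite conj_actE linear_sum; apply: eq_bigr => q _.
by rewrite gantipM !mactM !comp_lfunE.
Qed.

Definition conjmod : gmod G := @AMod k kG 'Hom(X, Y) conj_lin conj_lin_linear conj_lin1 conj_linM.

(** This is G-linearity of the evaluation [Hom(X, Y)] (x) [X -> Y]: by coassociativity the antipode
    of [a_2] meets [a_3] and cancels. *)
Lemma conj_act_comp a phi x :
  \sum_(p <- gcomul a) conj_act p.1 phi (mact X p.2 x) = mact Y a (phi x).
Proof.
have tP : @trilinear k kG Y (fun u v w => mact Y u (phi (mact X (gantip v) (mact X w x)))).
  split=> u v c z t /=; first by rewrite mactD mactZ.
    by rewrite gantip_linear mactD mactZ !linearP.
  by rewrite mactD mactZ !linearP.
under eq_bigr => p _ do rewrite conj_actE.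
rewrite (gcomulA a tP) /= -[in RHS](gcounitr a) mact_sum; apply: eq_bigr => p _.
rewrite -linear_sum -linear_sum /=.
under eq_bigr => q _ do rewrite -comp_lfunE -mactM.
by rewrite -mact_sum gantipl !mactZ mact1 id_lfunE !linearZ.
Qed.

Lemma conj_invariant_hom phi :
  (forall a, conj_act a phi = a 1 *: phi) -> is_hom phi.
Proof.
move=> phiI a x; rewrite -conj_act_comp -[in LHS](gcounitl a) mact_sum linear_sum.
by apply: eq_bigr => p _; rewrite phiI mactZ linearZ scale_lfunE.
Qed.

Variables (N : finGroupScheme k) (i : gs_hom N G).

Lemma gcomul_map (b : galg N) :
  tensor_eq (gcomul (galg_map i b))
            [seq (galg_map i p.1, galg_map i p.2) | p <- gcomul b].
Proof.
apply: tensor_eq_galg => x y; rewrite big_map /= gcomulE galg_mapE rmorphM -gcomulE.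
by apply: eq_bigr => p _; rewrite !galg_mapE.
Qed.

Lemma galg_map_1 (b : galg N) : galg_map i b 1 = b 1.
Proof. by rewrite galg_mapE rmorph1. Qed.

(** N-linearity moves [b_1] inside [phi], where it cancels against the antipode of [b_2]. *)
Lemma conj_act_res_hom (b : galg N) phi : @is_hom k (galg N) (res i X) (res i Y) phi ->
  conj_act (galg_map i b) phi = b 1 *: phi.
Proof.
move=> hphi; apply/lfunP=> x; rewrite conj_actE (gcomul_map b (conj_bilinear phi x)).
have FP : @bilinear_for k kG kG Y *:%R *:%R (fun u v => phi (mact X u (mact X (gantip v) x))).
  split=> u c v w /=; first by rewrite mactD mactZ !linearP.
  by rewrite gantip_linear mactD mactZ !linearP.
rewrite big_map /=; under eq_bigr => p _ do rewrite -[mact Y _ _](hphi p.1).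
have := gcomul_map b FP; rewrite big_map /= => <-; rewrite -linear_sum /=.
under eq_bigr => q _ do rewrite -comp_lfunE -mactM.
by rewrite -mact_sum gantipr galg_map_1 mactZ mact1 id_lfunE linearZ scale_lfunE.
Qed.

End Conjugation.

(** * Integrals and the Reynolds operator of the quotient *)

Section Reynolds.
Variable k : fieldType.

Definition galg_counit (G : finGroupScheme k) (a : galg G) : k^o := a 1.
Fact galg_counit_linear G : linear (@galg_counit G).
Proof. by move=> c a b; rewrite /galg_counit galgD galgZ. Qed.
HB.instance Definition _ G :=
  GRing.isLinear.Build k (galg G) k^o *:%R (@galg_counit G) (@galg_counit_linear G).

Variables (N G Q : finGroupScheme k).
Variables (i : gs_hom N G) (q : gs_hom G Q).

(** A linear form on the subspace [k[Q]] of [k[G]] extends to [k[G]]. *)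
Lemma galg_map_surj : injective q -> forall c : galg Q, exists a : galg G, galg_map q a = c.
Proof.
move=> q_inj c; pose l : 'Hom(fcoordring Q, fcoordring G) := linfun q.
have lE x : l x = q x by rewrite lfunE.
have l0 : lker l == 0%VS by apply/lker0P=> x y; rewrite !lE; exact: q_inj.
exists ((c : 'Hom(_, _)) \o l^-1)%VF; apply: galgP => x.
by rewrite galg_mapE /galg_fun comp_lfunE -lE lker0_lfunK.
Qed.

(** Take a left ideal [V] complementing the augmentation ideal [U], and let [t] be the [V]-component
    of 1. Then [a t - a(1) t] lies in both [U] and [V]. *)
Lemma linearly_reductive_integral : linearly_reductive Q ->
  exists t : galg Q, t 1 = 1 /\ forall a : galg Q, a * t = a 1 *: t.
Proof.
move=> lr.
pose U : {vspace regmod (galg Q)} := lker (linfun (@galg_counit Q)).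
have inU (a : galg Q) : (a \in U) = (a 1 == 0) by rewrite memv_ker lfunE.
have regE (a b : galg Q) : mact (regmod (galg Q)) a b = a * b by rewrite lfunE.
have [|V [sV UV UV0]] := lr U.
  move=> a; apply/subvP=> _ /memv_imgP[b + ->].
  by rewrite regE !inU (galgM_1 a b) => /eqP ->; rewrite mulr0.
have [u [t [uU tV ut]]] : exists u t : galg Q, [/\ u \in U, t \in V & 1 = u + t].
  have /memv_addP[u uU [t tV ut]] : (1 : galg Q) \in (U + V)%VS by rewrite UV memvf.
  by exists u, t.
have t1 : t 1 = 1.
  move: uU; rewrite inU => /eqP u1.
  by rewrite -[RHS](galg1_1 Q) ut galgD u1 add0r.
exists t; split=> // a; apply/eqP; rewrite -subr_eq0; set d := a * t - a 1 *: t.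
suff: d \in (U :&: V)%VS by rewrite UV0 memv0.
rewrite memv_cap inU; apply/andP; split.
  by rewrite /d -scaleN1r galgD !galgZ galgM_1 t1 mulr1 mulN1r subrr.
apply: memvB; last exact: memvZ.
by have := mact_sub sV a tV; rewrite regE.
Qed.

(* The matrix coefficients [a |-> xi (a v)] of an N-invariant vector [v] lie in
   k[G]^N = k[Q], so the kernel of kG -> kQ kills [v]. *)
Lemma invariant_kernel (V : gmod G) (v : V) (a : galg G) :
  is_quotient i q -> (forall b, mact V (galg_map i b) v = b 1 *: v) ->
  galg_map q a = 0 -> mact V a v = 0.
Proof.
move=> [_ quo] vN qa0.
rewrite (coord_vbasis (memvf (mact V a v))); apply: big1 => l _.
(* [c] is the matrix coefficient as an element of [k[G]], obtained from a form on [kG] by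
   finite-dimensional duality. *)
pose c := \sum_(m < \dim {:fcoordring G})
  coord (vbasis {:V}) l (mact V (dual_basis m) v) *: (vbasis {:fcoordring G})`_m.
have cE (b : galg G) : b c = coord (vbasis {:V}) l (mact V b v).
  rewrite {2}(galg_expand b) mact_sum linear_sum galg_sum; apply: eq_bigr => m _.
  by rewrite galg_scale mactZ linearZ mulrC.
have [b bc] : exists b : Q, q b = c.
  apply/quo.
  (* Invariance of [c] is tested on pairs of dual basis elements, where it becomes the invariance of
     [v] under [kN]. *)
  apply: (@tensor_eq_coord k (fcoordring G) (fcoordring N)) => r s.
  rewrite big_map big_seq1 /=.
  under eq_bigr => p _ do rewrite -!dual_basisE -galg_mapE.
  rewrite -galgM cE mactM comp_lfunE vN !linearZ /= -cE.
  by rewrite !dual_basisE mulrC.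
have : galg_map q a b = coord (vbasis {:V}) l (mact V a v) by rewrite galg_mapE bc cE.
by rewrite qa0 /galg_fun zero_lfunE => <-; rewrite scale0r.
Qed.

(** [t] lifts an integral of [kQ], so [a t - a(1) t] lies in the kernel of [kG -> kQ], which kills
    N-invariant vectors. *)
Lemma reynolds : is_quotient i q -> linearly_reductive Q ->
  exists t : galg G, t 1 = 1 /\
    forall (V : gmod G) (v : V), (forall b, mact V (galg_map i b) v = b 1 *: v) ->
    forall a, mact V a (mact V t v) = a 1 *: mact V t v.
Proof.
move=> quo lr; have [t' [t'1 t'E]] := linearly_reductive_integral lr.
have [t tE] := galg_map_surj (proj1 quo) t'; exists t; split.
  by rewrite -t'1 -tE galg_mapE rmorph1.
move=> V v vN a; apply/eqP; rewrite -subr_eq0; apply/eqP.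
have <- : mact V (a * t - a 1 *: t) v = mact V a (mact V t v) - a 1 *: mact V t v.
  by rewrite mactD -scaleN1r !mactZ scaleN1r mactM comp_lfunE.
apply: (invariant_kernel quo vN).
rewrite -scaleN1r scalerA addrC galg_map_linear galg_mapM tE t'E.
by rewrite galg_mapE rmorph1 mulN1r scaleNr addNr.
Qed.

End Reynolds.

(** * Almost split sequences with middle term X^n *)

Section Powers.
Variables (k : fieldType) (A : falgType k) (X : amod A) (n : nat).
Local Notation E := (powmod X n).

Definition pow_in_fun (l : 'I_n) (x : X) : {ffun 'I_n -> X} := [ffun i => (i == l)%:R *: x].
Fact pow_in_linear l : linear (pow_in_fun l).
Proof.
by move=> c x y; apply/ffunP=> i; rewrite !ffunE scalerDr !scalerA mulrC.
Qed.
HB.instance Definition _ l :=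
  GRing.isLinear.Build k X {ffun 'I_n -> X} *:%R (pow_in_fun l) (pow_in_linear l).
Definition pow_in l : 'Hom(X, E) := linfun (pow_in_fun l).

Definition pow_pr_fun (l : 'I_n) (v : {ffun 'I_n -> X}) : X := v l.
Fact pow_pr_linear l : linear (pow_pr_fun l).
Proof. by move=> c x y; rewrite /pow_pr_fun !ffunE. Qed.
HB.instance Definition _ l :=
  GRing.isLinear.Build k {ffun 'I_n -> X} X *:%R (pow_pr_fun l) (pow_pr_linear l).
Definition pow_pr l : 'Hom(E, X) := linfun (pow_pr_fun l).

Lemma pow_prE l (v : E) : pow_pr l v = (v : {ffun 'I_n -> X}) l.
Proof. by rewrite lfunE. Qed.

Lemma pow_pr_in l m x : pow_pr m (pow_in l x) = (m == l)%:R *: x.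
Proof. by rewrite pow_prE lfunE /= ffunE. Qed.

Lemma pow_pr_hom l : is_hom (pow_pr l).
Proof. by move=> a v; rewrite !pow_prE pow_actE. Qed.

Lemma pow_prP (u v : E) : (forall l, pow_pr l u = pow_pr l v) -> u = v.
Proof. by move=> uv; apply/ffunP=> l; have := uv l; rewrite !pow_prE. Qed.

Lemma pow_in_hom l : is_hom (pow_in l).
Proof.
move=> a x; apply: pow_prP => m.
by rewrite pow_pr_hom !pow_pr_in linearZ.
Qed.

Lemma pow_in_pr : (\sum_(l < n) (pow_in l \o pow_pr l))%VF = \1%VF :> 'End(E).
Proof.
apply/lfunP=> v; rewrite sum_lfunE id_lfunE; apply: pow_prP => m; rewrite linear_sum /=.
rewrite (bigD1 m) //= big1 => [|l lm]; rewrite comp_lfunE pow_pr_in.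
  by rewrite eqxx scale1r addr0.
by rewrite eq_sym (negPf lm) scale0r.
Qed.

End Powers.

(* [pr] identifies [I] with rad(X, M)/rad^2(X, M), so the components of [p] give
   vectors [v_l] of [I] and [s v_l] agrees with the l-th component up to an
   element of rad^2, which factors through [p] by a radical map.  As endomorphisms
   of [X] are scalar up to the radical, the [v_l] span [I]. *)
Lemma almost_split_irr (k : closedFieldType) (A : falgType k) (X M T E' : amod A) (n : nat)
    (j : 'Hom(T, powmod X n)) (p : 'Hom(powmod X n, M))
    (I : vectType k) (pr : 'Hom('Hom(X, M), I)) (s : I -> 'Hom(X, M))
    (p' : 'Hom(E', M)) (ins : 'Hom(I, 'Hom(X, E'))) :
  indecomposable X -> almost_split_exact j p ->
  (forall phi, rad phi -> (pr phi = 0 <-> rad2 phi)) ->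
  (forall v, rad (s v)) -> (forall v, pr (s v) = v) ->
  rad p' -> (forall v, is_hom (ins v)) -> (forall v, (p' \o ins v)%VF = s v) ->
  (forall U : {vspace E'}, (forall v x, ins v x \in U) -> U = fullv) ->
  exists2 b : 'Hom(E', powmod X n), is_iso b & (p \o b)%VF = p'.
Proof.
move=> Xi ip prP rs prs rp' hins p'ins gen; have [_ _ ras] := ip.
have M0 := right_almost_split_neq0 ras; have [hp _ lift] := ras.
have lift_rad (Z : amod A) (h : 'Hom(Z, M)) : rad h -> exists2 h', is_hom h' & h = (p \o h')%VF.
  by move=> rh; apply: lift; [exact: rad_hom | exact: rad_not_split_epi].
pose pl l := (p \o pow_in X l)%VF; pose v l := pr (pl l).
have rpl l : rad (pl l).
  by apply: rad_compr (right_almost_split_rad ras) _; exact: pow_in_hom.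
have [w wl] : exists w, forall l, rad (w l) /\ pl l = s (v l) + (p \o w l)%VF.
  apply: (fin_all_exists (P := fun l wl => rad wl /\ pl l = s (v l) + (p \o wl)%VF)) => l.
  have rd : rad (pl l - s (v l)) by apply: radD => //; exact/radN/rs.
  have [|Z [g [h [rg rh gh]]]] := (prP _ rd).1.
    by rewrite linearB /= prs subrr.
  have [h' hh' hE] := lift_rad _ _ rh.
  exists (h' \o g)%VF; split; first exact: rad_compl.
  by rewrite comp_lfunA -hE -gh addrC subrK.
set b' := (\sum_(l < n) (ins (v l) \o pow_pr X l))%VF.
have hb' : is_hom b'.
  by apply: is_hom_sum => l; apply: is_hom_comp => //; exact: pow_pr_hom.
apply: (@almost_split_transport k A T _ E' M j p p' b' (\sum_(l < n) (w l \o pow_pr X l))%VF) => //.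
- suff b'full : limg b' = fullv.
    move=> y; have /memv_imgP[x _ ->] : y \in limg b' by rewrite b'full memvf.
    by exists x.
  have b'in l x : b' (pow_in X l x) = ins (v l) x.
    rewrite sum_lfunE (bigD1 l) //= big1 => [|m ml]; rewrite comp_lfunE pow_pr_in.
      by rewrite eqxx scale1r addr0.
    by rewrite (negPf ml) scale0r linear0.
  apply: gen => u x; suff [c ->] : exists c : 'I_n -> k, u = \sum_l c l *: v l.
    rewrite linear_sum sum_lfunE; apply: memv_suml => l _.
    by rewrite linearZ scale_lfunE -b'in memvZ // memv_img ?memvf.
  have [h hh sE] := lift_rad _ _ (rs u).
  have [c rc] : exists c : 'I_n -> k, forall l, rad ((pow_pr X l \o h) - c l *: \1)%VF.
    apply: (fin_all_exists (P := fun l c => rad ((pow_pr X l \o h) - c *: \1)%VF)) => l.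
    by apply: indecomposable_scalar_rad => //; apply: is_hom_comp => //; exact: pow_pr_hom.
  exists c.
  (* Insert the identity of [X^n] between [p] and the lift [h], and write each component of [h] as
     the scalar [c l] plus a radical map. *)
  have suE : s u = \sum_l (c l *: pl l + (pl l \o ((pow_pr X l \o h) - c l *: \1))%VF).
    rewrite sE -[in LHS](comp_lfun1l h) -pow_in_pr; apply/lfunP=> y.
    rewrite comp_lfunE [X in p X]comp_lfunE !sum_lfunE linear_sum; apply: eq_bigr => l _.
    rewrite add_lfunE scale_lfunE [in RHS]comp_lfunE add_lfunE opp_lfunE scale_lfunE.
    rewrite id_lfunE !comp_lfunE.
    by rewrite linearB linearB !linearZ /= scalerN addrC subrK.
  rewrite -[u in LHS]prs suE linear_sum; apply: eq_bigr => l _.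
  rewrite linearD linearZ /= -/(v l) [X in _ + X](_ : _ = 0) ?addr0 //.
  have rr : rad (pl l \o ((pow_pr X l \o h) - c l *: \1))%VF.
    by apply: rad_compl => //; exact: rad_hom.
  by apply/(prP _ rr); exists X, ((pow_pr X l \o h) - c l *: \1)%VF, (pl l).
- by apply: rad_sum => l; apply: rad_compr (wl l).1 _; exact: pow_pr_hom.
apply/lfunP=> x; rewrite -[in LHS](comp_lfun1r p) -pow_in_pr add_lfunE !comp_lfunE !sum_lfunE.
rewrite !linear_sum -big_split; apply: eq_bigr => l _ /=.
have := congr1 (fun f : 'Hom(X, M) => f (pow_pr X l x)) (wl l).2.
by rewrite add_lfunE -p'ins !comp_lfunE.
Qed.

(** * Tensor products *)

Section TensorMaps.
Variables (k : fieldType) (U V : vectType k).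

Lemma lfun_of_basis (W : vectType k) (f : 'I_(\dim {:V}) -> W) :
  exists s : 'Hom(V, W), forall l : 'I_(\dim {:V}), s (vbasis {:V})`_l = f l.
Proof.
have [g gP] := linear_of_free (vbasis {:V}) (codom f).
exists (linfun g) => l; rewrite lfunE /=.
have sz : size (codom f) = size (vbasis {:V}) by rewrite size_codom card_ord size_tuple.
rewrite -(nth_map 0 0 g) ?size_tuple //= gP ?(basis_free (vbasisP _)) //.
by rewrite codomE (nth_map l) ?size_enum_ord // nth_ord_enum.
Qed.

(** The contraction [id] (x) [xi]; contractions separate tensors. *)
Definition tens_ev_fun (xi : 'Hom(V, k^o)) (t : tensor U V) : U := (t : 'Hom('Hom(V, k^o), U)) xi.
Fact tens_ev_linear xi : linear (tens_ev_fun xi).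
Proof. by move=> c t u; rewrite /tens_ev_fun add_lfunE scale_lfunE. Qed.
HB.instance Definition _ xi :=
  GRing.isLinear.Build k (tensor U V) U *:%R (tens_ev_fun xi) (tens_ev_linear xi).
Definition tens_ev xi : 'Hom(tensor U V, U) := linfun (tens_ev_fun xi).

Lemma tens_evE xi t : tens_ev xi t = (t : 'Hom('Hom(V, k^o), U)) xi.
Proof. by rewrite lfunE. Qed.

Lemma tensE u v xi : (tens u v : 'Hom('Hom(V, k^o), U)) xi = (xi v : k) *: u.
Proof. by rewrite lfunE. Qed.

Lemma tensorP (t u : tensor U V) : (forall xi, tens_ev xi t = tens_ev xi u) -> t = u.
Proof. by move=> tu; apply/lfunP=> xi; rewrite -!tens_evE. Qed.

Definition tens_in_fun (v : V) (u : U) : tensor U V := tens u v.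
Fact tens_in_linear v : linear (tens_in_fun v).
Proof.
move=> c u w; apply: tensorP => xi; rewrite linearP /= !tens_evE /tens_in_fun !tensE.
by rewrite scalerDr !scalerA mulrC.
Qed.
HB.instance Definition _ v :=
  GRing.isLinear.Build k U (tensor U V) *:%R (tens_in_fun v) (tens_in_linear v).
Definition tens_in v : 'Hom(U, tensor U V) := linfun (tens_in_fun v).

Lemma tens_inE v u : tens_in v u = tens u v. Proof. by rewrite lfunE. Qed.

Fact tens_ins_linear : linear tens_in.
Proof.
move=> c v w; apply/lfunP=> u; apply: tensorP => xi.
rewrite add_lfunE scale_lfunE linearP /= !tens_evE !tens_inE !tensE linearP.
by rewrite scalerDl scalerA.
Qed.
HB.instance Definition _ :=
  GRing.isLinear.Build k V 'Hom(U, tensor U V) *:%R tens_in tens_ins_linear.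
Definition tens_ins : 'Hom(V, 'Hom(U, tensor U V)) := linfun tens_in.

Lemma tens_insE v u : tens_ins v u = tens u v.
Proof. by rewrite lfunE tens_inE. Qed.

Definition dual_coord (l : 'I_(\dim {:V})) : 'Hom(V, k^o) :=
  linfun (coord (vbasis {:V}) l : V -> k^o).

Lemma tens_expand (t : tensor U V) :
  t = \sum_(l < \dim {:V}) tens (tens_ev (dual_coord l) t) (vbasis {:V})`_l.
Proof.
apply/lfunP=> xi; rewrite sum_lfunE; under eq_bigr => l _ do rewrite tensE tens_evE -linearZ.
rewrite -linear_sum; congr (t _); apply/lfunP=> v.
rewrite sum_lfunE {1}(coord_vbasis (memvf v)) linear_sum; apply: eq_bigr => l _.
rewrite scale_lfunE lfunE linearZ /=; exact: mulrC.
Qed.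

(** The map induced by [s] on the tensor product, written in a basis of [V] because tensors are
    encoded as maps on the dual of [V]. *)
Definition uncurry (W : vectType k) (s : 'Hom(V, 'Hom(U, W))) : 'Hom(tensor U V, W) :=
  (\sum_(l < \dim {:V}) (s (vbasis {:V})`_l \o tens_ev (dual_coord l)))%VF.

Lemma uncurry_tens (W : vectType k) (s : 'Hom(V, 'Hom(U, W))) u v :
  uncurry s (tens u v) = s v u.
Proof.
rewrite sum_lfunE {2}(coord_vbasis (memvf v)) linear_sum sum_lfunE.
apply: eq_bigr => l _; rewrite linearZ scale_lfunE comp_lfunE tens_evE tensE lfunE.
by rewrite linearZ.
Qed.

Lemma tensor_spanned (W : {vspace tensor U V}) : (forall v u, tens_ins v u \in W) -> W = fullv.
Proof.
move=> insW; apply/eqP; rewrite eqEsubv subvf; apply/subvP=> t _.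
by rewrite (tens_expand t); apply: memv_suml => l _; rewrite -tens_insE.
Qed.

End TensorMaps.
Arguments tens_ev {k U V} xi.
Arguments tens_ins {k} U V.

(** * Equivariance of the maps into and out of [X] (x) [I] *)

Section MainConstruction.
Variables (k : fieldType) (G : finGroupScheme k) (X I M : gmod G).

(** Equivariance of [s] reduces this to G-linearity of evaluation; cocommutativity puts the Sweedler
    factors in the right order. *)
Lemma uncurry_hom (s : 'Hom(I, conjmod X M)) : is_hom s ->
  @is_hom k (galg G) (tensmod X I) M (uncurry (s : 'Hom(I, 'Hom(X, M)))).
Proof.
move=> hs a t; rewrite (tens_expand t) !linear_sum; apply: eq_bigr => l _ /=.
move: (tens_ev _ t) => x; move: (_`_l) => v.
rewrite tensmodE linear_sum uncurry_tens -conj_act_comp.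
have FP : @bilinear_for k (galg G) (galg G) M *:%R *:%R
    (fun b c => (conj_act b (s v : 'Hom(X, M))) (mact X c x)).
  split=> u c y z /=; first by rewrite conj_act_additive add_lfunE scale_lfunE.
  by rewrite mactD mactZ !linearP.
rewrite (gcomulC a FP) big_map /=; apply: eq_bigr => p _.
by rewrite uncurry_tens hs conj_linE.
Qed.

Variables (N : finGroupScheme k) (i : gs_hom N G).
Hypothesis trivI : forall b v, mact I (galg_map i b) v = b 1 *: v.

Lemma galg_map_counit (b : galg N) :
  galg_map i b = \sum_(p <- gcomul b) (p.2 : galg N) 1 *: galg_map i p.1.
Proof.
rewrite -{1}(gcounitr b); elim: (gcomul b) => [|p r IH].
  by rewrite !big_nil; apply: galgP => x; rewrite galg_mapE /galg_fun !zero_lfunE.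
by rewrite !big_cons galg_map_linear IH.
Qed.

(** As N acts on [I] through the counit, the diagonal action of N on [X] (x) [I] is the action on
    [X] alone. *)
Lemma tens_ev_res_hom xi : @is_hom k (galg N) (res i (tensmod X I)) (res i X) (tens_ev xi).
Proof.
move=> b t; rewrite !tens_evE /= /diag_act.
have FP := @diag_act_bilinear k G X I _ _ (@tens_map_bilinear k X I).
rewrite (gcomul_map i b FP) big_map /= !sum_lfunE.
transitivity (mact X (galg_map i b) (tens_ev xi t)); last by rewrite tens_evE.
rewrite (galg_map_counit b) mact_sum; apply: eq_bigr => p _; rewrite tens_mapE mactZ tens_evE.
have -> : (xi \o mact I (galg_map i p.2))%VF = (p.2 : galg N) 1 *: xi.
  by apply/lfunP=> v; rewrite comp_lfunE trivI scale_lfunE linearZ.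
by rewrite !linearZ.
Qed.

Lemma tens_in_res_hom v : @is_hom k (galg N) (res i X) (res i (tensmod X I)) (tens_ins X I v).
Proof.
move=> b x; apply: tensorP => xi; rewrite tens_ev_res_hom !tens_evE !tens_insE !tensE.
by rewrite linearZ.
Qed.

End MainConstruction.

(** * The equivariant section *)

Section Irr.
Variables (k : fieldType) (N G Q : finGroupScheme k).
Variables (i : gs_hom N G) (q : gs_hom G Q) (X M I : gmod G).
Variable pr : 'Hom('Hom(X, M), I).
Hypothesis irrI : is_Irr i pr.

Local Notation radN phi := (@rad k (galg N) (res i X) (res i M) phi).

(** Classes in [I] are represented by N-linear maps, which conjugation by N fixes. *)
Lemma Irr_trivial b v : mact I (galg_map i b) v = b 1 *: v.
Proof.
have [_ prS prC] := irrI; have [phi rphi <-] := prS v.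
have [_ <-] := prC (galg_map i b) phi rphi.
by rewrite (conj_act_res_hom b (rad_hom rphi)) linearZ.
Qed.

(* A linear section of [pr] on the radical is N-invariant, so averaging it with
   the Reynolds operator of [Q] makes it G-equivariant. *)
Lemma Irr_section : is_quotient i q -> linearly_reductive Q ->
  exists s : 'Hom(I, conjmod X M),
    [/\ is_hom s, forall v, radN (s v) & forall v, pr (s v) = v].
Proof.
move=> quo lr; have [pr0 prS prC] := irrI.
have [t [t1 tP]] := reynolds quo lr.
have [f fP] : exists f : 'I_(\dim {:I}) -> 'Hom(X, M),
    forall l, radN (f l) /\ pr (f l) = (vbasis {:I})`_l.
  apply: (fin_all_exists (P := fun (l : 'I_(\dim {:I})) (phi : 'Hom(X, M)) => radN phi /\ pr phi = (vbasis {:I})`_l)) => l.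
  by have [phi rphi prphi] := prS (vbasis {:I})`_l; exists phi.
have [s0 s0E] := @lfun_of_basis k I 'Hom(X, M) f.
have rs0 v : radN (s0 v).
  rewrite (coord_vbasis (memvf v)) linear_sum; apply: rad_sum => l.
  by rewrite linearZ /= s0E; apply: radZ; case: (fP l).
have prs0 v : pr (s0 v) = v.
  rewrite {1}(coord_vbasis (memvf v)) !linear_sum [RHS](coord_vbasis (memvf v)).
  by apply: eq_bigr => l _; rewrite !linearZ /= s0E; case: (fP l) => _ ->.
(* The section becomes a vector of the G-module [Hom(I, Hom(X, M))]. N acts trivially on [I] and on
   the values of [s0], so [s0] is N-linear and this vector is N-invariant, as [reynolds]
   requires. *)
pose S0 : conjmod I (conjmod X M) := s0.
have hS0 : @is_hom k (galg N) (res i I) (res i (conjmod X M)) s0.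
  move=> b v; rewrite [mact _ b v]Irr_trivial linearZ /=.
  rewrite -[RHS]/(conj_lin X M (galg_map i b) (s0 v)) conj_linE.
  by rewrite (conj_act_res_hom b (rad_hom (rs0 v))).
have S0N b : mact (conjmod I (conjmod X M)) (galg_map i b) S0 = b 1 *: S0.
  rewrite -[LHS]/(conj_lin I (conjmod X M) (galg_map i b) S0) conj_linE.
  exact: conj_act_res_hom.
pose s : 'Hom(I, conjmod X M) := conj_act t S0.
have sI a : conj_act a s = a 1 *: s.
  have := tP _ S0 S0N a; rewrite -[mact _ t S0]/(conj_lin I (conjmod X M) t S0) conj_linE.
  by rewrite -[X in X = _ -> _]/(conj_lin I (conjmod X M) a _) conj_linE.
have sE v : s v = \sum_(p <- gcomul t) conj_act p.1 (s0 (mact I (gantip p.2) v)) :> 'Hom(X, M).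
  rewrite /s conj_actE; apply: eq_bigr => p _.
  by rewrite -[LHS]/(conj_lin X M p.1 _) conj_linE.
exists s; split; first exact: conj_invariant_hom.
  by move=> v; rewrite sE; apply: rad_sum => p; case: (prC p.1 _ (rs0 (mact I (gantip p.2) v))).
(* Equivariance of [pr] turns the average into the sum of [t_1 S(t_2) v], which is [t(1) v = v]. *)
move=> v; rewrite sE linear_sum.
under eq_bigr => p _.
  have [_ /= ->] := prC p.1 _ (rs0 (mact I (gantip p.2) v)).
  rewrite prs0 -comp_lfunE -mactM.
  over.
by rewrite -mact_sum gantipr t1 scale1r mact1 id_lfunE.
Qed.

End Irr.

(** * The exact sequence over G and its comparison with the almost split sequence over N *)

Theorem proposition1p4
  (k : closedFieldType) (H : groupScheme k) (G N Q : finGroupScheme k)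
  (iG : gs_hom G H) (iN : gs_hom N G) (q : gs_hom G Q)
  (redH : reduced H)
  (subG : closed_immersion iG) (subN : closed_immersion iN)
  (normN : normal_via (fun a : H => iN (iG a)))
  (quoQ : is_quotient iN q) (lrQ : linearly_reductive Q)
  (X M : gmod G)
  (indX : indecomposable X) (indM : indecomposable M)
  (indXN : indecomposable (res iN X))
  (n : nat) (T : gmod N)
  (j : 'Hom(T, powmod (res iN X) n)) (p : 'Hom(powmod (res iN X) n, res iN M))
  (tauM : is_AR_translate (res iN M) T)
  (assE : almost_split_exact j p)
  (I : gmod G) (pr : 'Hom('Hom(X, M), I)) (irrI : is_Irr iN pr) :
  exists (L : gmod G) (j' : 'Hom(L, tensmod X I)) (p' : 'Hom(tensmod X I, M)),
    short_exact j' p' /\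
    exists (a : 'Hom(res iN L, T))
           (b : 'Hom(res iN (tensmod X I), powmod (res iN X) n)),
      [/\ is_iso a, is_iso b,
          forall x, j (a x) = b (j' x) & forall t, p (b t) = p' t].
Proof.
have trivI := Irr_trivial irrI; have [prP _ _] := irrI.
have [s [hs rs prs]] := Irr_section irrI quoQ lrQ.
pose p' : 'Hom(tensmod X I, M) := uncurry (s : 'Hom(I, 'Hom(X, M))).
have hp' : is_hom p' := uncurry_hom hs.
have rp' : @rad k (galg N) (res iN (tensmod X I)) (res iN M) p'.
  (* [p'] is a sum of N-linear contractions followed by the radical maps [s v_l], for [v_l] in a
     basis of [I]. *)
  apply: (@rad_sum k (galg N) (res iN (tensmod X I)) (res iN M)) => l.
  apply: (@rad_compr k (galg N) (res iN (tensmod X I)) (res iN X) (res iN M)); first exact: rs.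
  exact: tens_ev_res_hom.
have [b bI pb] : exists2 b : 'Hom(res iN (tensmod X I), powmod (res iN X) n),
    is_iso b & (p \o b)%VF = p'.
  apply: (@almost_split_irr k (galg N) (res iN X) (res iN M) T (res iN (tensmod X I)) n j p
            I pr s p' (tens_ins X I)) => //.
  - exact: tens_in_res_hom.
  - by move=> v; apply/lfunP=> x; rewrite comp_lfunE tens_insE uncurry_tens.
  - exact: tensor_spanned.
have pbE t : p (b t) = p' t by rewrite -pb comp_lfunE.
have [[hj hp j0 jp pfull] _ _] := assE.
have j_inj : injective j by apply/lker0P/eqP.
pose L : gmod G := submod (submodule_lker hp').
pose j' : 'Hom(L, tensmod X I) := sub_incl (lker p').
have j'K x : p' (j' x) = 0.
  by apply/eqP; rewrite -memv_ker /j' sub_inclE subvsP.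
(* [b] carries [ker p'] into [ker p = im j], so [j] can be inverted there. *)
pose a : 'Hom(res iN L, T) := (j^-1 \o b \o j')%VF.
have aE x : j (a x) = b (j' x).
  by rewrite !comp_lfunE limg_lfunVK // jp memv_ker pbE j'K.
have [hb _] := bI.
exists L, j', p'; split.
  split.
  - exact: sub_incl_hom.
  - exact: hp'.
  - by apply/eqP/lker0P/sub_incl_inj.
  - apply/vspaceP=> t; apply/memv_imgP/idP => [[x _ ->]|tK].
      by rewrite memv_ker j'K.
    by exists (sub_proj (lker p') t); rewrite ?memvf ?sub_projK.
  apply/eqP; rewrite eqEsubv subvf; apply/subvP=> m _.
  have /memv_imgP[e _ ->] : m \in limg p by rewrite pfull memvf.
  have [t <-] := is_iso_surj bI e.
  by rewrite pbE memv_img ?memvf.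
exists a, b; split=> //; apply: is_iso_bij.
- move=> c x; apply: j_inj; rewrite aE hj aE -hb; congr (b _).
  exact: (@sub_incl_hom _ _ _ _ (submodule_lker hp') (galg_map iN c) x).
- by move=> x y axy; apply: (@sub_incl_inj _ _ (tensmod X I) (lker p')); apply: (is_iso_inj bI);
    rewrite -!aE axy.
(* The preimage of [j y] under [b] lies in [ker p'] because [p j = 0]. *)
move=> y; have [t tE] := is_iso_surj bI (j y).
have tK : t \in lker p' by rewrite memv_ker -pbE tE -memv_ker -jp memv_img ?memvf.
exists (sub_proj (lker p') t); apply: j_inj.
by rewrite aE -tE /j' sub_projK.
Qed.
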